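(* Let $k$ be a positive integer and let $T_k$ be the infinite $k$-ary tree, that is, the rooted tree in which every vertex has exactly $k$ children. Then $\rho(T_k)=f(k)$.
   Context: Let $K_{\mathbb{N}}$ be the complete graph on the natural numbers $\mathbb{N}=\{1,2,\dots\}$, and $[n]=\{1,\dots,n\}$. For $S\subseteq\mathbb{N}$ the (upper) density is $\bar d(S)=\limsup_{n\to\infty}|S\cap[n]|/n$, and for a subgraph $H'\subseteq K_{\mathbb{N}}$ we set $\bar d(H')=\bar d(V(H'))$. For a countably infinite graph $H$ (vertex set of the same cardinality as $\mathbb{N}$), the Ramsey upper density $\rho(H)$ is the supremum of the values $\lambda$ for which, for every two-coloring of $E(K_{\mathbb{N}})$, there exists a monochromatic (not necessarily induced) subgraph $H'\subseteq K_{\mathbb{N}}$, isomorphic to $H$, with $\bar d(H')\geq\lambda$. Definition of $f:[0,+\infty]\to\mathbb{R}$. Let $\gamma\in(-1,1)$. For a continuous $g:[0,+\infty)\to\mathbb{R}$ let $\Gamma^+_\gamma(g,t)=\min\{x:\gamma x+g(x)\geq t\}$ and $\Gamma^-_\gamma(g,t)=\min\{x:\gamma x-g(x)\geq t\}$, the minimum of the empty set being $+\infty$. Let $h(\gamma)=\inf_g\limsup_{t\to\infty}\frac{\Gamma^+_\gamma(g,t)+\Gamma^-_\gamma(g,t)}{t}$, the infimum being over all 1-Lipschitz functions $g:[0,+\infty)\to\mathbb{R}$ with $g(0)=0$ (1-Lipschitz: $|g(x)-g(y)|\leq|x-y|$ for all $x,y$). For $\lambda\in(0,+\infty)$ set \[f(\lambda)=1-\frac{1}{\frac{2\lambda}{(1+\lambda)^2}h\left(\frac{\lambda-1}{\lambda+1}\right)+\frac{2\lambda}{1+\lambda}},\]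 and $f(0)=1$, $f(+\infty)=1/2$. *)

(* Defs.v *)
From mathcomp Require Import all_boot all_order all_algebra finmap.
From mathcomp Require Import all_classical all_reals all_analysis.

Set Implicit Arguments.
Unset Strict Implicit.
Unset Printing Implicit Defensive.

Import Order.TTheory GRing.Theory Num.Theory.
Import numFieldNormedType.Exports.

Local Open Scope classical_set_scope.
Local Open Scope ring_scope.

(* Simple graphs, possibly infinite.  The vertex set is a subset of an ambient
   type, so that a subgraph is again a graph over the same type. *)
Record graph (T : Type) := Graph {
  vset : set T;
  adj : T -> T -> Prop;
  adj_vset : forall x y, adj x y -> vset x /\ vset y;
  adj_sym : forall x y, adj x y -> adj y x;
  adj_irr : forall x, ~ adj x x
}.

Definition subgraph (T : Type) (G' G : graph T) : Prop :=
  vset G' `<=` vset G /\ (forall x y, adj G' x y -> adj G x y).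

Definition isomorphic (T U : Type) (G : graph T) (H : graph U) : Prop :=
  exists2 phi : T -> U, set_bij (vset G) (vset H) phi &
    forall x y, vset G x -> vset G y -> (adj G x y <-> adj H (phi x) (phi y)).

Definition KN_vset : set nat := [set n | (0 < n)%N].
Definition KN_adj (x y : nat) : Prop := [/\ KN_vset x, KN_vset y & x <> y].

Lemma KN_adj_vset x y : KN_adj x y -> KN_vset x /\ KN_vset y.
Proof. by case. Qed.

Lemma KN_adj_sym x y : KN_adj x y -> KN_adj y x.
Proof. by case=> hx hy nxy; split => // /esym. Qed.

Lemma KN_adj_irr x : ~ KN_adj x x.
Proof. by case. Qed.

Definition KN : graph nat := Graph KN_adj_vset KN_adj_sym KN_adj_irr.

(* A two-colouring of the edges of [KN] is a function [c : nat -> nat -> bool]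
   with [symmetric c]; its values on the diagonal and at 0 are never used. *)
Definition monochromatic (c : nat -> nat -> bool) (G : graph nat) : Prop :=
  exists b : bool, forall x y, adj G x y -> c x y = b.

Definition upper_density (R : realType) (S : set nat) : R :=
  limn_sup (fun n : nat =>
    #|` fset_set (S `&` [set m | (1 <= m <= n)%N]) |%:R / n%:R : R).

(* For a countably infinite [H] the set below contains 0, by Ramsey's theorem,
   and is bounded above by 1. *)
Definition ramsey_upper_density (R : realType) (T : Type) (H : graph T) : R :=
  sup [set l : R | forall c : nat -> nat -> bool, symmetric c ->
    exists H' : graph nat, [/\ subgraph H' KN, monochromatic c H',
      isomorphic H H' & l <= upper_density R (vset H')]].

(* Vertices of the k-ary tree are the finite words over ['I_k]: the root is
   [[::]] and the children of [x] are the words [rcons x i]. *)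
Definition child (k : nat) (x y : seq 'I_k) : Prop := exists i, y = rcons x i.

Definition tree_adj (k : nat) (x y : seq 'I_k) : Prop := child x y \/ child y x.

Lemma tree_adj_vset k (x y : seq 'I_k) :
  tree_adj x y -> [set: seq 'I_k] x /\ [set: seq 'I_k] y.
Proof. by []. Qed.

Lemma tree_adj_sym k (x y : seq 'I_k) : tree_adj x y -> tree_adj y x.
Proof. by case; [right|left]. Qed.

Lemma tree_adj_irr k (x : seq 'I_k) : ~ tree_adj x x.
Proof.
by case=> -[i] /(congr1 size) /eqP; rewrite size_rcons eqn_leq ltnn andbF.
Qed.

Definition kary_tree (k : nat) : graph (seq 'I_k) :=
  Graph (@tree_adj_vset k) (@tree_adj_sym k) (@tree_adj_irr k).

Lemma kary_tree_vset_card (k : nat) : (0 < k)%N ->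
  (vset (kary_tree k) #= [set: nat])%card.
Proof.
move=> k_gt0; pose i0 := Ordinal k_gt0.
apply/card_eqPle; split; first exact: countableP.
have nseq_inj : set_inj [set: nat] (fun n => nseq n i0).
  by move=> m n _ _ /(congr1 size); rewrite !size_nseq.
by rewrite -(card_le_eql (inj_card_eq nseq_inj)); exact: subset_card_le.
Qed.

Section DensityFunction.
Variable R : realType.
Local Open Scope ereal_scope.

(* The minimum of [A], and [+oo] if [A] has no minimum.  For the closed
   subsets of [0, +oo) to which it is applied this happens only for the
   empty set. *)
Definition emin (A : set R) : \bar R :=
  xget +oo [set x%:E | x in A `&` lbound A].

(* A function on [0, +oo) is a function on [R] of which only the values on
   [0, +oo) are used. *)
Definition Gamma_plus (gamma : R) (g : R -> R) (t : R) : \bar R :=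
  emin [set x | 0 <= x /\ t <= gamma * x + g x]%R.

Definition Gamma_minus (gamma : R) (g : R -> R) (t : R) : \bar R :=
  emin [set x | 0 <= x /\ t <= gamma * x - g x]%R.

Definition hfun (gamma : R) : \bar R :=
  ereal_inf [set limf_esup
      (fun t => (Gamma_plus gamma g t + Gamma_minus gamma g t) * (t^-1)%:E)
      (pinfty_nbhs R)
    | g in [set g : R -> R |
             (1.-lipschitz_(`[0%R, +oo[) (g : R -> R)) /\ g 0%R = 0%R]].

(* [hfun gamma] is finite for -1 < gamma < 1, so that [fine] is harmless.
   The values at negative arguments and at [-oo] are irrelevant. *)
Definition tree_density (l : \bar R) : R :=
  match l with
  | x%:E => if x == 0%R then 1%R else
      (1 - 1 / (2 * x / (1 + x) ^+ 2 * fine (hfun ((x - 1) / (x + 1)))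
                + 2 * x / (1 + x)))%R
  | +oo => (1 / 2)%R
  | -oo => 0%R
  end.

End DensityFunction.

(* Main.v *)
Require Import Defs.
From mathcomp Require Import all_boot all_order all_algebra finmap.
From mathcomp Require Import all_classical all_reals all_analysis.
From mathcomp Require Import zify lra ring.

(** Write gamma = (k-1)/(k+1), c = (k+1)/(2k) and h = hfun gamma. The claimed
    density is 1 - c / (1 + h/(k+1)), and c(gamma x - y) is what becomes of
    b - r/k when b + r = x and r - b = y.

    Upper bound. A 1-Lipschitz function g with g(0) = 0 describes how red and
    blue vertices alternate in a listing: the first x vertices contain
    r(x) = (x + g(x))/2 red and b(x) = (x - g(x))/2 blue ones. Colour an edge
    inside a class by that class, and an edge between the classes by the class
    of its endpoint that is listed first. In a red copy of the tree each blue
    vertex has k children, which are red and listed before it, and distinct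
    vertices have distinct children. Hence at most r(x)/k of the first b(x)
    blue vertices belong to the copy, and b(x) - r(x)/k = c(gamma x - g(x)) of
    them are missed. At x = Gamma_minus(t) this number is c t, and a blue copy
    misses c t of the first r(x) red vertices at x = Gamma_plus(t). The natural
    numbers can be assigned to the two classes in such a way that some initial
    segment consists of exactly the first b(Gamma_minus(t)) blue and
    r(Gamma_plus(t)) red vertices. Its length is
    t + (Gamma_plus(t) + Gamma_minus(t))/(k+1), so every monochromatic copy has
    a proportion c / (1 + h/(k+1)) of gaps if g is almost optimal
    ([upper_colouring]).

    Lower bound. An ultrafilter splits the vertices into two classes such that
    finitely many vertices of one class always have common neighbours, in the
    colour of the class, arbitrarily far away ([vertex_colouring]). With such
    connectors a tree of colour chi can be made to contain the whole class of
    chi, together with any finite forest in which the vertices of the other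
    class have k children and a parent in the class of chi, joined to them by
    edges of colour chi ([tree_of_stages], [insert_forest]). The forests are
    added at a sparse sequence of scales n, so that what has been used earlier
    is negligible ([dense_tree]).

    Such a forest covers, up to a small error, the number of vertices up to n
    that a duality argument allows ([forest_or_obstruction]). A maximum flow in
    which every edge has capacity 1 and every vertex a capacity linear in n is
    a star packing spread over many edges. A random assignment of the vertices
    to boundedly many layers preserves it on every pair of layers, by a second
    moment estimate, and there Hall's theorem, again a case of max-flow min-cut,
    turns it into disjoint stars. Children are chosen in the layer of the vertex
    and parents in the previous layer; the layers exclude cycles. If the forest
    is too small, the minimum cut consists of a set I of vertices up to n and a
    set N in the class of chi such that |I| - |N|/k is at least a given delta n
    and almost no edge of colour chi leads from I to the class of chi outside N.

    Suppose both colours are obstructed at all large scales, by (I_n, N_n) and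
    by (J_m, M_m). Between I_n minus M_m and J_m minus N_n there are few edges
    of either colour, so one of the two sets is small: |J_m| <= |N_n| or
    |I_n| <= |M_m| up to an error. This says exactly that the points
    (|I_n| + |N_n|, |N_n| - |I_n|) and (|J_m| + |M_m|, |J_m| - |M_m|) can be
    separated by a 1-Lipschitz function, which passes below the former and above
    the latter ([lipschitz_separation]). Since |I_n| + |J_n| <= n, the values of
    Gamma_plus and Gamma_minus for this function are so small that delta cannot
    exceed c / (1 + h/(k+1)) ([hfun_le_deficits], [tree_density_lower]). *)

Set Implicit Arguments.
Unset Strict Implicit.
Unset Printing Implicit Defensive.

Import Order.TTheory GRing.Theory Num.Theory.

(** * Integral flows in bipartite networks *)

Local Open Scope nat_scope.

(** Value of the cut with source side I and N, in the network in which a source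
    is joined to x with capacity a x, x to y with capacity c x y, and y to a sink
    with capacity b y. *)
Definition cut (X Y : finType) (a : X -> nat) (b : Y -> nat)
    (c : X -> Y -> nat) (I : {set X}) (N : {set Y}) : nat :=
  \sum_x (x \notin I) * a x + \sum_y (y \in N) * b y
  + \sum_x \sum_y (x \in I) * (y \notin N) * c x y.

(** Cut functions are submodular, strictly so when an edge runs between the two
    differences: the edge (x, y) contributes to the second cut on the right and
    to neither cut on the left. *)
Lemma cut_uncross (X Y : finType) a b c (I1 I2 : {set X}) (N1 N2 : {set Y})
    (x : X) (y : Y) :
  x \notin I1 -> y \in N1 -> x \in I2 -> y \notin N2 -> 0 < c x y ->
  cut a b c (I1 :&: I2) (N1 :&: N2) + cut a b c (I1 :|: I2) (N1 :|: N2)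
  < cut a b c I1 N1 + cut a b c I2 N2.
Proof.
move=> xI1 yN1 xI2 yN2 cxy; rewrite /cut.
have Ea : \sum_u (u \notin I1 :&: I2) * a u + \sum_u (u \notin I1 :|: I2) * a u
       = \sum_u (u \notin I1) * a u + \sum_u (u \notin I2) * a u.
  rewrite -!big_split /=; apply: eq_bigr => u _; rewrite !inE.
  by case: (u \in I1); case: (u \in I2) => /=; lia.
have Eb : \sum_v (v \in N1 :&: N2) * b v + \sum_v (v \in N1 :|: N2) * b v
       = \sum_v (v \in N1) * b v + \sum_v (v \in N2) * b v.
  rewrite -!big_split /=; apply: eq_bigr => v _; rewrite !inE.
  by case: (v \in N1); case: (v \in N2) => /=; lia.
suff Ec : \sum_u \sum_v (u \in I1 :&: I2) * (v \notin N1 :&: N2) * c u v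
        + \sum_u \sum_v (u \in I1 :|: I2) * (v \notin N1 :|: N2) * c u v
     < \sum_u \sum_v (u \in I1) * (v \notin N1) * c u v
        + \sum_u \sum_v (u \in I2) * (v \notin N2) * c u v by lia.
rewrite -!big_split /= (bigD1 x) //= [ltnRHS](bigD1 x) //=.
rewrite -!big_split /= -addSn leq_add //.
- rewrite (bigD1 y) //= [ltnRHS](bigD1 y) //= !inE.
  rewrite (negbTE xI1) yN1 xI2 (negbTE yN2) /= -addSn leq_add //; first by lia.
  by apply: leq_sum => v _; rewrite !inE /=; case: (v \in N1); case: (v \in N2) => /=; lia.
- apply: leq_sum => u _; rewrite -!big_split /=; apply: leq_sum => v _.
  rewrite !inE.
  by case: (u \in I1); case: (u \in I2); case: (v \in N1); case: (v \in N2) => /=; lia.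
Qed.

Lemma sum_decrement (X : finType) (P : pred X) (F : X -> nat) (x : X) :
  \sum_u P u * (F u - (u == x)) + P x * (0 < F x) = \sum_u P u * F u.
Proof.
rewrite (bigD1 x) //= [RHS](bigD1 x) //= eqxx.
under eq_bigr => u /negbTE -> do rewrite subn0.
by case: (F x) => [|n]; case: (P x) => /=; lia.
Qed.

(** Induction on the total edge capacity. A usable edge (x, y) either carries a
    unit of an optimal flow or can be removed; the two failures would need two
    minimum cuts, one with y but not x and one with x but not y, on the source
    side, and these cannot coexist by [cut_uncross]. *)
Lemma max_flow_min_cut (X Y : finType) (a : X -> nat) (b : Y -> nat)
    (c : X -> Y -> nat) :
  exists f : X -> Y -> nat, exists I : {set X}, exists N : {set Y},
  [/\ forall x y, f x y <= c x y, forall x, \sum_y f x y <= a x,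
      forall y, \sum_x f x y <= b y &
      cut a b c I N <= \sum_x \sum_y f x y].
Proof.
suff H mu : (forall I N, mu <= cut a b c I N) ->
    exists f : X -> Y -> nat,
    [/\ forall x y, f x y <= c x y, forall x, \sum_y f x y <= a x,
      forall y, \sum_x f x y <= b y & mu <= \sum_x \sum_y f x y].
  pose i0 : {set X} * {set Y} := (finset.set0, finset.set0).
  case: (arg_minnP (fun IN : {set X} * {set Y} => cut a b c IN.1 IN.2)
    (erefl : predT i0)) => -[I N] _ /= hmin.
  have [|f [h1 h2 h3 h4]] := H (cut a b c I N).
    by move=> I' N'; apply: (hmin (I', N')).
  by exists f, I, N.
have [n] := ubnP (\sum_x \sum_y c x y).
elim: n mu a b c => // n IH mu a b c; rewrite ltnS => hn hmu.
case: (pickP [pred p : X * Y | [&& 0 < c p.1 p.2, 0 < a p.1 & 0 < b p.2]]);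
  last first.
  (* Every edge is blocked: the cut formed by the usable sources and the
     saturated sinks has value 0, so the zero flow is maximal. *)
  move=> h0; exists (fun _ _ => 0); split=> //.
  - by move=> x; rewrite big1.
  - by move=> y; rewrite big1.
  apply: leq_trans (hmu [set x | 0 < a x] [set y | b y == 0]) _.
  rewrite /cut [X in X + _ + _]big1 ?[X in _ + X + _]big1 ?[X in _ + _ + X]big1 //.
  - move=> x _; rewrite big1 // => y _; rewrite !inE.
    have := h0 (x, y) => /=; case: (c x y) => [|?]; first by rewrite muln0.
    by case: (a x) => [|?] //=; case: (b y).
  - by move=> y _; rewrite inE; case: (b y).
  - by move=> x _; rewrite inE; case: (a x).
move=> [x y] /= /and3P[cxy ax bY].
pose c' u v := c u v - ((u == x) && (v == y)).
have c'E u v : c' u v + ((u == x) && (v == y)) = c u v.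
  rewrite /c'; case: (u =P x) => [->|_] /=; last lia.
  by case: (v =P y) => [->|_] /=; lia.
have sumc' (I : pred X) (N : pred Y) :
   \sum_u \sum_v I u * N v * c' u v + I x * N y = \sum_u \sum_v I u * N v * c u v.
  rewrite (bigD1 x) //= [RHS](bigD1 x) //=.
  rewrite [X in X + _ + _ = _](bigD1 y) //= [X in _ = X + _](bigD1 y) //=.
  under eq_bigr => v vy do rewrite /c' (negbTE vy) andbF subn0.
  under [X in _ + X + _ = _]eq_bigr => u ux do
    under eq_bigr => v _ do rewrite /c' (negbTE ux) /= subn0.
  by rewrite /c' !eqxx /=; case: (I x); case: (N y) => /=; lia.
have sumlt : \sum_u \sum_v c' u v < n.
  have := sumc' xpredT xpredT.
  under eq_bigr => u _ do under eq_bigr => v _ do rewrite !mul1n.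
  under [RHS]eq_bigr => u _ do under eq_bigr => v _ do rewrite !mul1n.
  by lia.
case: (boolP [exists IN : {set X} * {set Y},
   [&& x \notin IN.1, y \in IN.2 & cut a b c IN.1 IN.2 <= mu]]).
  (* A minimum cut separates (x, y) in the backward direction. By uncrossing
     no minimum cut then uses the edge, which can be removed. *)
  move=> /existsP[[I1 N1]] /= /and3P[xI1 yN1 hc1].
  have [|f [h1 h2 h3 h4]] := IH mu a b c' sumlt.
    move=> I N; rewrite -(leq_add2r ((x \in I) * (y \notin N))).
    have E3 := sumc' (fun u => u \in I) (fun v => v \notin N).
    have {E3}-> : cut a b c' I N + (x \in I) * (y \notin N) = cut a b c I N.
      by rewrite /cut -addnA E3.
    case: (boolP ((x \in I) && (y \notin N))) => [/andP[xI yN]|h]; last first.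
      rewrite mulnb (negbTE h) addn0; exact: hmu.
    have := cut_uncross a b xI1 yN1 xI yN cxy.
    have := hmu (I1 :&: I) (N1 :&: N); have := hmu (I1 :|: I) (N1 :|: N).
    by rewrite xI yN /=; lia.
  exists f; split=> // u v; apply: leq_trans (h1 u v) _; rewrite -(c'E u v); lia.
move=> /existsPn hA.
(* Otherwise sending one unit along (x, y) lowers every minimum cut by
   exactly one. *)
have [|f [h1 h2 h3 h4]] := IH mu.-1 (fun u => a u - (u == x))
  (fun v => b v - (v == y)) c' sumlt.
  move=> I N.
  have E1 := sum_decrement (fun u => u \notin I) a x.
  have E2 := sum_decrement (fun v => v \in N) b y.
  have E3 := sumc' (fun u => u \in I) (fun v => v \notin N).
  have := hA (I, N); have := hmu I N; rewrite /= /cut.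
  move: E1 E2 E3; rewrite ax bY /=.
  by case: (x \in I); case: (y \in N) => /=; lia.
have S1 u : \sum_v (f u v + ((u == x) && (v == y))) = \sum_v f u v + (u == x).
  rewrite big_split /=; congr (_ + _).
  case: (u == x) => /=; last by rewrite big1.
  by rewrite (bigD1 y) //= eqxx big1 // => v /negbTE ->.
have S2 v : \sum_u (f u v + ((u == x) && (v == y))) = \sum_u f u v + (v == y).
  rewrite big_split /=; congr (_ + _).
  under eq_bigr do rewrite andbC; case: (v == y) => /=; last by rewrite big1.
  by rewrite (bigD1 x) //= eqxx big1 // => u /negbTE ->.
exists (fun u v => f u v + ((u == x) && (v == y))); split.
- by move=> u v; rewrite -(c'E u v) leq_add2r.
- by move=> u; rewrite S1; have := h2 u; case: (eqVneq u x) => [->|_] /=; lia.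
- by move=> v; rewrite S2; have := h3 v; case: (eqVneq v y) => [->|_] /=; lia.
- under eq_bigr do rewrite S1; rewrite big_split /=.
  rewrite [X in _ + X](bigD1 x) //= eqxx [X in 1 + X]big1 ?addn0; first lia.
  by move=> u /negbTE ->.
Qed.

(** * Finite product measures *)

Local Open Scope ring_scope.

Section ProductMeasure.
Variables (R : realFieldType) (V O : finType) (p : V -> O -> R).
Hypothesis p_ge0 : forall v o, 0 <= p v o.
Hypothesis p_sum1 : forall v, \sum_o p v o = 1.

(** Expectation for independent coordinates, the coordinate of v having the
    distribution p v. *)
Definition expect (F : {ffun V -> O} -> R) : R :=
  \sum_(w : {ffun V -> O}) (\prod_v p v (w v)) * F w.

Lemma eq_expect F G : F =1 G -> expect F = expect G.
Proof. by move=> FG; apply: eq_bigr => w _; rewrite FG. Qed.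

Lemma expect_prod (h : V -> O -> R) :
  expect (fun w => \prod_v h v (w v)) = \prod_v \sum_o p v o * h v o.
Proof.
by rewrite bigA_distr_bigA /=; apply: eq_bigr => w _; rewrite big_split.
Qed.

Lemma expect_cst c : expect (fun=> c) = c.
Proof.
rewrite /expect -mulr_suml -[RHS]mul1r; congr (_ * _).
by rewrite -(bigA_distr_bigA p) big1.
Qed.

Lemma expectD F G : expect (fun w => F w + G w) = expect F + expect G.
Proof. by rewrite -big_split; apply: eq_bigr => w _; rewrite mulrDr. Qed.

Lemma expectZ c F : expect (fun w => c * F w) = c * expect F.
Proof. by rewrite mulr_sumr; apply: eq_bigr => w _; rewrite mulrCA. Qed.

Lemma expectN F : expect (fun w => - F w) = - expect F.
Proof. by rewrite -mulN1r -expectZ; apply: eq_expect => w; rewrite mulN1r. Qed.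

Lemma expect_sum (I : finType) (P : pred I) (F : I -> {ffun V -> O} -> R) :
  expect (fun w => \sum_(i | P i) F i w) = \sum_(i | P i) expect (F i).
Proof.
by rewrite /expect exchange_big; apply: eq_bigr => w _; rewrite mulr_sumr.
Qed.

Lemma expect_le F G : (forall w, F w <= G w) -> expect F <= expect G.
Proof. by move=> FG; apply: ler_sum => w _; rewrite ler_wpM2l// prodr_ge0. Qed.

Lemma expect_attained F : exists w, expect F <= F w.
Proof.
have [w hw|h] := pickP (fun w => expect F <= F w); first by exists w.
have [w0 _|h0] := pickP (@predT {ffun V -> O}); last first.
  have := expect_cst 1; rewrite /expect big_pred0 => [/esym/eqP|w].
    by rewrite oner_eq0.
  by have := h0 w.
pose w1 := [arg max_(w > w0) F w]%O.
exists w1; rewrite -[leRHS]expect_cst; apply: expect_le => w.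
by rewrite /w1; case: arg_maxP => // i _; apply.
Qed.

Lemma expect_coord v a : expect (fun w => (w v == a)%:R) = p v a.
Proof.
transitivity (expect (fun w => \prod_u (if u == v then (w u == a)%:R else 1))).
  apply: eq_expect => w; rewrite (bigD1 v) //= eqxx big1 ?mulr1 //.
  by move=> u /negbTE ->.
rewrite (expect_prod (fun u o => if u == v then (o == a)%:R else 1)).
rewrite (bigD1 v) //= eqxx [X in _ * X]big1 ?mulr1.
  rewrite (bigD1 a) //= eqxx mulr1 big1 ?addr0 // => o /negbTE ->.
  by rewrite mulr0.
move=> u /negbTE ->; under eq_bigr do rewrite mulr1; exact: p_sum1.
Qed.

Lemma expect_coord2 u v a : u != v ->
  expect (fun w => (w u == a)%:R * (w v == a)%:R) = p u a * p v a.
Proof.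
move=> uv.
pose h x o : R := if (x == u) || (x == v) then (o == a)%:R else 1.
have vu : v != u by rewrite eq_sym.
transitivity (expect (fun w => \prod_x h x (w x))).
  apply: eq_expect => w; rewrite (bigD1 u) //= (bigD1 v) //= /h !eqxx orbT /=.
  by rewrite big1 ?mulr1 // => x /andP[/negbTE -> /negbTE ->].
have hp x : (x == u) || (x == v) -> \sum_o p x o * h x o = p x a.
  move=> hx; rewrite (bigD1 a) //= /h hx eqxx mulr1 big1 ?addr0 // => o.
  by move=> /negbTE ->; rewrite mulr0.
rewrite expect_prod (bigD1 u) //= (bigD1 v) //= !hp ?eqxx ?orbT //.
rewrite big1 ?mulr1 // => x /andP[/negbTE xu /negbTE xv].
by under eq_bigr do rewrite /h xu xv mulr1; exact: p_sum1.
Qed.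

(** Distinct coordinates are uncorrelated, so only the diagonal terms survive,
    and the variance of an indicator is at most its mean. *)
Lemma expect_variance (w : V -> R) a :
  expect (fun o => (\sum_v w v * (o v == a)%:R - \sum_v w v * p v a) ^+ 2)
  <= \sum_v w v ^+ 2 * p v a.
Proof.
pose d v (o : {ffun V -> O}) : R := (o v == a)%:R - p v a.
have dE (o : {ffun V -> O}) : (\sum_v w v * (o v == a)%:R - \sum_v w v * p v a) ^+ 2
    = \sum_u \sum_v (w u * w v) * (d u o * d v o).
  rewrite -sumrB expr2 mulr_suml; apply: eq_bigr => u _.
  rewrite mulr_sumr; apply: eq_bigr => v _; rewrite /d; ring.
rewrite (eq_expect dE) expect_sum; apply: ler_sum => u _.
rewrite expect_sum (bigD1 u) //= big1 ?addr0; last first.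
  move=> v vu; rewrite expectZ.
  have -> : expect (fun o => d u o * d v o) = 0; last by rewrite mulr0.
  transitivity (expect (fun o => (o u == a)%:R * (o v == a)%:R
     + ((- p v a) * (o u == a)%:R + ((- p u a) * (o v == a)%:R + p u a * p v a)))).
    by apply: eq_expect => o; rewrite /d; ring.
  rewrite expectD expect_coord2 1?eq_sym // !expectD !expectZ !expect_coord.
  by rewrite expect_cst; ring.
rewrite expectZ -expr2 ler_wpM2l ?sqr_ge0 //.
apply: (@le_trans _ _ (expect (fun o => (1 - 2 * p u a) * (o u == a)%:R + p u a ^+ 2))).
  apply: expect_le => o; rewrite /d; case: (o u == a) => /=; last lra.
  by rewrite le_eqVlt; apply/orP; left; apply/eqP; ring.
rewrite expectD expectZ expect_coord expect_cst.
have := sqr_ge0 (p u a); lra.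
Qed.

End ProductMeasure.

(** * Star packings and layered forests *)

(** Hall's theorem with deficiency d for disjoint stars with q leaves. It is
    max-flow min-cut with capacity q at the centres. The condition is that of the
    cuts: it counts the edges from A' that leave an arbitrary set N, and is
    verified below in this form. *)
Lemma star_packing (R : realFieldType) (X Y : finType) (e : X -> Y -> bool)
    (A : {set X}) (B : {set Y}) (q : nat) (d : R) :
  (forall (A' : {set X}) (N : {set Y}), A' \subset A ->
     q%:R * #|A'|%:R <= #|N :&: B|%:R
       + \sum_(x in A') \sum_(y in B :\: N) (e x y)%:R + d) ->
  exists (S : {set X}) (C : X -> {set Y}),
  [/\ S \subset A, #|A|%:R - d <= #|S|%:R,
      forall x, x \in S ->
        [/\ #|C x| = q, C x \subset B & forall y, y \in C x -> e x y] &
      forall x x' y, x \in S -> x' \in S -> y \in C x -> y \in C x' -> x = x'].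
Proof.
move=> hall.
have [f [I [N [fc fa fb fcut]]]] := max_flow_min_cut
  (fun x => (x \in A) * q)%N (fun y => nat_of_bool (y \in B))
  (fun x y => nat_of_bool [&& x \in A, y \in B & e x y]).
pose C x := [set y | (0 < f x y)%N].
have fle1 x y : (f x y <= 1)%N by apply: leq_trans (fc x y) (leq_b1 _).
have rowC x : (\sum_y f x y = #|C x|)%N.
  rewrite -sum1_card [RHS]big_mkcond /=; apply: eq_bigr => y _; rewrite inE.
  by have := fle1 x y; case: (f x y) => [|[|]].
have rowle x : (#|C x| <= (x \in A) * q)%N by rewrite -rowC; exact: fa.
pose S := [set x in A | #|C x| == q].
exists S, C; split.
- by apply/fintype.subsetP => x; rewrite inE => /andP[].
- have cutE : cut (fun x => (x \in A) * q)%N (fun y => nat_of_bool (y \in B))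
     (fun x y => nat_of_bool [&& x \in A, y \in B & e x y]) I N
     = (q * #|A :\: I| + #|N :&: B|
       + \sum_(x in A :&: I) \sum_(y in B :\: N) e x y)%N.
    rewrite /cut; congr (_ + _ + _)%N.
    + rewrite -sum1_card big_distrr /= [RHS]big_mkcond /=.
      apply: eq_bigr => x _; rewrite !inE.
      by case: (x \in A); case: (x \in I) => //=; lia.
    + rewrite -sum1_card [RHS]big_mkcond /=; apply: eq_bigr => y _.
      by rewrite inE; case: (y \in N); case: (y \in B).
    + rewrite [RHS]big_mkcond /=; apply: eq_bigr => x _; rewrite inE.
      case: (x \in A) => /=; last by rewrite big1 // => y _; rewrite muln0.
      case: (x \in I) => /=; last by rewrite big1.
      rewrite [RHS]big_mkcond /=; apply: eq_bigr => y _; rewrite inE.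
      by case: (y \in B); case: (y \in N); case: (e x y).
  have unsat : (\sum_x #|C x| + #|A :\: S| <= q * #|A|)%N.
    rewrite -!sum1_card big_distrr /= [X in (_ + X <= _)%N]big_mkcond /=.
    rewrite [leqRHS]big_mkcond -big_split /=; apply: leq_sum => x _.
    have := rowle x; rewrite !inE; case: (x \in A) => /=; last by lia.
    by case: eqVneq => /=; lia.
  move: fcut; rewrite cutE; under [X in (_ <= X)%N]eq_bigr do rewrite rowC.
  have := hall (A :&: I) N (finset.subsetIl _ _).
  have -> : \sum_(x in A :&: I) \sum_(y in B :\: N) (e x y)%:R
     = (\sum_(x in A :&: I) \sum_(y in B :\: N) e x y)%N%:R :> R.
    by rewrite natr_sum; apply: eq_bigr => x _; rewrite natr_sum.
  have := cardsID I A; have := cardsID S A.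
  rewrite (finset.setIidPr (_ : S \subset A)); last first.
    by apply/fintype.subsetP => x; rewrite inE => /andP[].
  set s := (\sum_(x in _) _)%N; move=> E2 E1 h hc.
  have : (q * #|A :\: I| + #|N :&: B| + s + #|A :\: S| <= q * #|A|)%N by lia.
  rewrite -(ler_nat R) !natrD !natrM -E1 natrD mulrDr => h1.
  have E3 : #|A :&: I|%:R + #|A :\: I|%:R = #|S|%:R + #|A :\: S|%:R :> R.
    by rewrite -!natrD E1 E2.
  by lra.
- move=> x; rewrite inE => /andP[xA /eqP hC]; split=> //.
    apply/fintype.subsetP => y; rewrite inE => fxy; have := fc x y.
    by case: (y \in B) => //; rewrite andbF leqn0; case: (f x y) fxy.
  move=> y; rewrite inE => fxy; have := fc x y.
  by case: (e x y) => //; rewrite !andbF leqn0; case: (f x y) fxy.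
- move=> x x' y _ _; rewrite !inE => fx fx'; apply/eqP/negP => /negP xx'.
  have := fb y; rewrite (bigD1 x) //= (bigD1 x') 1?eq_sym //=.
  by move: fx fx'; case: (y \in B) => /=; lia.
Qed.

(** Layers are drawn independently, x receiving each of the l + 1 layers with
    probability phi x / (l+1) and y with probability 1/(l+1). The weight that x
    sends into a layer and the weight that y receives from a layer are sums of
    independent terms of size at most kap, so they are concentrated. Deviations
    d are measured by eta + d^2/eta, which bounds |d| and whose expectation is
    at most 2 eta. The statement bounds one combination of all the errors, so
    that a single outcome at least as good as the expectation suffices. *)
Lemma random_layers (R : realFieldType) (X Y : finType) (l : nat)
    (phi : X -> R) (v : X -> Y -> R) (eta kap W : R) :
  0 < eta -> 0 <= W -> 0 <= kap <= eta ^+ 2 ->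
  (forall x, 0 <= phi x <= 1) -> (forall x y, 0 <= v x y <= kap) ->
  (forall x, phi x != 0 -> \sum_y v x y = 1) ->
  (forall y, \sum_x phi x * v x y <= 1) ->
  exists (lx : X -> option 'I_l.+1) (ly : Y -> option 'I_l.+1),
    (1 - l.+1%:R^-1) * \sum_x phi x
      - W * (2 * eta * l.+1%:R * (#|X|%:R + #|Y|%:R))
    <= \sum_(i < l.+1 | i != ord0) \sum_(x | phi x != 0) (lx x == Some i)%:R
     - W * \sum_(i < l.+1) (
         \sum_(x | phi x != 0)
           (eta + (\sum_y v x y * (ly y == Some i)%:R - l.+1%:R^-1) ^+ 2 / eta)
       + \sum_y (eta + (\sum_x v x y * (lx x == Some i)%:R
                   - l.+1%:R^-1 * \sum_x phi x * v x y) ^+ 2 / eta)).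
Proof.
move=> eta0 W0 /andP[kap0 hkap] hphi hv hv1 hcol.
set inv : R := l.+1%:R^-1.
have l0 : 0 < l.+1%:R :> R by rewrite ltr0n.
have inv0 : 0 < inv by rewrite invr_gt0.
have inv1 : inv <= 1 by rewrite invf_le1 // ler1n.
have linv : l.+1%:R * inv = 1 by rewrite mulfV // gt_eqF.
(* A vertex x is kept with probability phi x, so that the selected vertices
   carry the weight v x y undiminished. *)
pose p (u : X + Y) (o : option 'I_l.+1) : R :=
  match u, o with
  | inl x, None => 1 - phi x
  | inl x, Some _ => phi x * inv
  | inr y, None => 0
  | inr y, Some _ => inv
  end.
have sum_opt (F : option 'I_l.+1 -> R) :
    \sum_o F o = F None + \sum_(i < l.+1) F (Some i).
  rewrite (bigD1 None) //=; congr (_ + _).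
  rewrite (reindex_omap Some id) /=; last by case.
  by apply: eq_bigl => i; rewrite eqxx.
have p_ge0 u o : 0 <= p u o.
  case: u o => [x|y] [i|] //=; last exact: ltW.
    by rewrite mulr_ge0 ?(ltW inv0) //; case/andP: (hphi x).
  by rewrite subr_ge0; case/andP: (hphi x).
have p_sum1 u : \sum_o p u o = 1.
  rewrite sum_opt; case: u => [x|y] /=; rewrite sumr_const card_ord -mulr_natl.
    by rewrite mulrCA linv; lra.
  by rewrite linv add0r.
pose lx (w : {ffun X + Y -> option 'I_l.+1}) x := w (inl x).
pose ly (w : {ffun X + Y -> option 'I_l.+1}) y := w (inr y).
pose devX w i x := (\sum_y v x y * (ly w y == Some i)%:R - inv) ^+ 2.
pose devY w i y := (\sum_x v x y * (lx w x == Some i)%:R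
                   - inv * \sum_x phi x * v x y) ^+ 2.
have EdX i x : phi x != 0 -> expect p (fun w => devX w i x) <= eta ^+ 2.
  move=> x0; pose wt (u : X + Y) := if u is inr y then v x y else 0.
  have -> : expect p (fun w => devX w i x) = expect p (fun w =>
     (\sum_u wt u * (w u == Some i)%:R - \sum_u wt u * p u (Some i)) ^+ 2).
    apply: eq_expect => w; rewrite /devX !big_sumType /=.
    rewrite [in RHS]big1 ?add0r; last by move=> ? _; rewrite mul0r.
    rewrite [X in _ = (_ - (X + _)) ^+ 2]big1 ?add0r; last by move=> ? _; rewrite mul0r.
    by rewrite -mulr_suml hv1 // mul1r.
  apply: le_trans (expect_variance p_ge0 p_sum1 wt (Some i)) _.
  rewrite big_sumType /= big1 ?add0r; last by move=> ? _; rewrite expr0n mul0r.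
  apply: (@le_trans _ _ (\sum_y kap * v x y)); last first.
    by rewrite -mulr_sumr hv1 // mulr1.
  apply: ler_sum => y _; have /andP[v0 vk] := hv x y.
  rewrite expr2 -[leRHS]mulr1 ler_pM ?mulr_ge0 ?ler_pM //; exact: ltW.
have EdY i y : expect p (fun w => devY w i y) <= eta ^+ 2.
  pose wt (u : X + Y) := if u is inl x then v x y else 0.
  have -> : expect p (fun w => devY w i y) = expect p (fun w =>
     (\sum_u wt u * (w u == Some i)%:R - \sum_u wt u * p u (Some i)) ^+ 2).
    apply: eq_expect => w; rewrite /devY !big_sumType /=.
    rewrite [X in _ = (_ + X - _) ^+ 2]big1; last by move=> ? _; rewrite mul0r.
    rewrite [X in _ = (_ - (_ + X)) ^+ 2]big1; last by move=> ? _; rewrite mul0r.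
    rewrite !addr0 mulr_sumr; congr ((_ - _) ^+ 2); apply: eq_bigr => x _; ring.
  apply: le_trans (expect_variance p_ge0 p_sum1 wt (Some i)) _.
  rewrite big_sumType /= [X in _ + X]big1 ?addr0; last first.
    by move=> ? _; rewrite expr0n mul0r.
  apply: (@le_trans _ _ (\sum_x kap * (phi x * v x y))); last first.
    by rewrite -mulr_sumr; apply: le_trans hkap; rewrite ler_piMr.
  apply: ler_sum => x _; have /andP[v0 vk] := hv x y; have /andP[f0 _] := hphi x.
  have -> : v x y ^+ 2 * (phi x * inv) = (v x y * inv) * (phi x * v x y) by ring.
  by rewrite ler_wpM2r ?mulr_ge0 // (le_trans _ vk) // ler_piMr.
have E0 : expect p (fun w => \sum_(i < l.+1 | i != ord0)
    \sum_(x | phi x != 0) (lx w x == Some i)%:R) = (1 - inv) * \sum_x phi x.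
  rewrite expect_sum (eq_bigr (fun=> inv * \sum_x phi x)) => [|i _].
    rewrite sumr_const -mulr_natl mulrA; congr (_ * _).
    have -> : #|(fun i : 'I_l.+1 => i != ord0)| = l.
      by have := cardC1 (@ord0 l); rewrite card_ord.
    by move: linv; rewrite -natr1; lra.
  rewrite expect_sum mulr_sumr [LHS]big_mkcond /=; apply: eq_bigr => x _.
  rewrite (expect_coord p_sum1) /=; case: eqP => [->|_] /=; first by rewrite mulr0.
  by rewrite mulrC.
have [w hw] := expect_attained p_ge0 p_sum1 (fun w =>
  \sum_(i < l.+1 | i != ord0) \sum_(x | phi x != 0) (lx w x == Some i)%:R
     - W * \sum_(i < l.+1) (
         \sum_(x | phi x != 0) (eta + devX w i x / eta)
       + \sum_y (eta + devY w i y / eta))).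
exists (lx w), (ly w); apply: le_trans hw.
rewrite expectD E0 expectN expectZ lerD2l lerN2 ler_wpM2l //.
rewrite expect_sum.
have dle z : z <= eta ^+ 2 -> eta + z / eta <= 2 * eta.
  move=> hz; have : z / eta <= eta by rewrite ler_pdivrMr // -expr2.
  lra.
apply: (@le_trans _ _ (\sum_(i < l.+1) (2 * eta * (#|X|%:R + #|Y|%:R)))).
  apply: ler_sum => i _; rewrite expectD mulrDr lerD // expect_sum.
    rewrite -sum1_card natr_sum mulr_sumr [leLHS]big_mkcond /=.
    apply: ler_sum => x _; rewrite mulr1; case: ifP => [x0|_]; last lra.
    under eq_expect do rewrite [_ / eta]mulrC.
    by rewrite expectD expect_cst // expectZ mulrC dle // EdX.
  rewrite -sum1_card natr_sum mulr_sumr; apply: ler_sum => y _; rewrite mulr1.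
  under eq_expect do rewrite [_ / eta]mulrC.
  by rewrite expectD expect_cst // expectZ mulrC dle.
rewrite sumr_const card_ord -mulr_natl; lra.
Qed.

(** The children C x and the parent P x of x in A make up k + 1 neighbours of x in Y.
    Going from x to P x, and on to the vertex of which P x is a child, decreases
    the layer; so the union of these stars is a forest, in which the degrees are
    those of the k-ary tree at A. *)
Definition forest_in (X Y : finType) (k : nat) (e : X -> Y -> bool)
    (A : {set X}) (C : X -> {set Y}) (P : X -> Y) (lx : X -> nat) (ly : Y -> nat)
    : Prop :=
  [/\ forall x, x \in A -> [/\ #|C x| = k, e x (P x) & forall y, y \in C x -> e x y],
      forall x x' y, x \in A -> x' \in A -> y \in C x -> y \in C x' -> x = x',
      forall x x', x \in A -> x' \in A -> P x = P x' -> x = x',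
      forall x, x \in A -> (ly (P x)).+1 = lx x &
      forall x y, x \in A -> y \in C x -> ly y = lx x].

(** A fractional star packing v that is regular up to D1 on the side of A and up
    to D2 on the side of B witnesses Hall's condition: the weight sent by A' is
    received in N or crosses one of the edges from A' to the rest of B, each of
    which carries little. *)
Lemma hall_of_layers (R : realFieldType) (X Y : finType) (e : X -> Y -> bool)
    (A : {set X}) (B : {set Y}) (k q : nat) (v : X -> Y -> R) (kap inv D1 D2 : R) :
  (0 < k)%N -> (q <= k)%N -> 0 < inv -> 0 <= D1 + D2 ->
  (forall x y, 0 <= v x y <= kap * (e x y)%:R) -> k%:R * kap <= inv ->
  (forall A' : {set X}, A' \subset A ->
     #|A'|%:R * inv <= \sum_(x in A') \sum_(y in B) v x y + D1) ->
  (forall N : {set Y}, N \subset B ->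
     \sum_(y in N) \sum_(x in A) v x y <= #|N|%:R * (inv / k%:R) + D2) ->
  forall (A' : {set X}) (N : {set Y}), A' \subset A ->
     q%:R * #|A'|%:R <= #|N :&: B|%:R
       + \sum_(x in A') \sum_(y in B :\: N) (e x y)%:R + k%:R / inv * (D1 + D2).
Proof.
move=> k0 qk inv0 D0 hv hkap hX hY A' N sA.
have k0R : 0 < k%:R :> R by rewrite ltr0n.
apply: (@le_trans _ _ (k%:R * #|A'|%:R)); first by rewrite ler_wpM2r // ler_nat.
have h1 := hX A' sA.
have h2 := hY (N :&: B) (finset.subsetIr _ _).
have h3 : \sum_(x in A') \sum_(y in B) v x y
   <= \sum_(y in N :&: B) \sum_(x in A) v x y
    + kap * \sum_(x in A') \sum_(y in B :\: N) (e x y)%:R.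
  rewrite exchange_big (bigID (mem N)) /=; apply: lerD.
    rewrite (eq_bigl (mem (N :&: B))); last by move=> y; rewrite !inE andbC.
    apply: ler_sum => y _; rewrite [leLHS]big_mkcond [leRHS]big_mkcond /=.
    apply: ler_sum => x _; case: ifP => [/(fintype.subsetP sA) -> //|_].
    by case: ifP => // _; case/andP: (hv x y).
  rewrite mulr_sumr (eq_bigl (mem (B :\: N))); last first.
    by move=> y; rewrite !inE andbC.
  under [leRHS]eq_bigr do rewrite mulr_sumr.
  rewrite [leRHS]exchange_big /=.
  by apply: ler_sum => y _; apply: ler_sum => x _; case/andP: (hv x y).
set s := \sum_(x in A') \sum_(y in _) _ in h3 *.
have s0 : 0 <= s by apply: sumr_ge0 => x _; apply: sumr_ge0.
have h4 : kap * s <= inv / k%:R * s.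
  by rewrite ler_wpM2r // ler_pdivlMr // mulrC.
have : #|A'|%:R * inv <= (inv / k%:R) * (#|N :&: B|%:R + s) + (D1 + D2) by lra.
move=> h5.
have ki0 : 0 < k%:R / inv by rewrite divr_gt0.
have E1 : k%:R / inv * (#|A'|%:R * inv) = k%:R * #|A'|%:R.
  by field; rewrite gt_eqF.
have E2 : k%:R / inv * (inv / k%:R * (#|N :&: B|%:R + s) + (D1 + D2))
   = #|N :&: B|%:R + s + k%:R / inv * (D1 + D2).
  by field; rewrite !gt_eqF.
by rewrite -E1 -E2 ler_pM2l.
Qed.

Lemma le_add_sqr_div (R : realFieldType) (eta z : R) :
  0 < eta -> z <= eta + z ^+ 2 / eta.
Proof.
move=> eta0; have [zle|/ltW zge] := leP z eta.
  by rewrite ler_wpDr // divr_ge0 ?sqr_ge0 // ltW.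
rewrite ler_wpDl ?(ltW eta0) // ler_pdivlMr // expr2 ler_wpM2l //.
exact: le_trans (ltW eta0) zge.
Qed.

(** [star_packing] is applied to each layer of X, once with the same layer of Y
    to find children and once with the previous layer of Y to find a parent. The
    defects are small because the weights v are almost regular between any two
    layers. *)
Lemma forest_of_layers (R : realFieldType) (X Y : finType) (y0 : Y) (l k : nat)
    (phi : X -> R) (f : X -> Y -> bool) (v : X -> Y -> R) (eta kap : R)
    (lx : X -> option 'I_l.+1) (ly : Y -> option 'I_l.+1) (inv := l.+1%:R^-1) :
  (0 < k)%N -> 0 < eta -> (forall x, 0 <= phi x) ->
  (forall x y, 0 <= v x y <= kap * (f x y)%:R) -> k%:R * kap <= inv ->
  (forall y, \sum_x phi x * v x y <= k%:R^-1) ->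
  exists A C P mx my, forest_in k f A C P mx my /\
    \sum_(i < l.+1 | i != ord0) \sum_(x | phi x != 0) (lx x == Some i)%:R
     - (2 * k%:R * l.+1%:R ^+ 2) * \sum_(i < l.+1) (
         \sum_(x | phi x != 0)
           (eta + (\sum_y v x y * (ly y == Some i)%:R - inv) ^+ 2 / eta)
       + \sum_y (eta + (\sum_x v x y * (lx x == Some i)%:R
                   - inv * \sum_x phi x * v x y) ^+ 2 / eta))
    <= #|A|%:R :> R.
Proof.
move=> k0 eta0 phi0 hv hkap hcol.
have l0 : 0 < l.+1%:R :> R by rewrite ltr0n.
have inv0 : 0 < inv by rewrite invr_gt0.
have k0R : 0 < k%:R :> R by rewrite ltr0n.
have v0 x y : 0 <= v x y by case/andP: (hv x y).
pose eX i x := eta + (\sum_y v x y * (ly y == Some i)%:R - inv) ^+ 2 / eta.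
pose eY i y := eta + (\sum_x v x y * (lx x == Some i)%:R
                   - inv * \sum_x phi x * v x y) ^+ 2 / eta.
have eX0 i x : 0 <= eX i x by rewrite addr_ge0 ?divr_ge0 ?sqr_ge0 // ltW.
have eY0 i y : 0 <= eY i y by rewrite addr_ge0 ?divr_ge0 ?sqr_ge0 // ltW.
pose D1 := \sum_i \sum_(x | phi x != 0) eX i x.
pose D2 := \sum_i \sum_y eY i y.
have D10 : 0 <= D1 by apply: sumr_ge0 => i _; apply: sumr_ge0.
have D20 : 0 <= D2 by apply: sumr_ge0 => i _; apply: sumr_ge0.
rewrite big_split /= -/D1 -/D2.
pose XL i := [set x | phi x != 0 & lx x == Some i].
pose YL i := [set y | ly y == Some i].
pose d := k%:R / inv * (D1 + D2).
have pack i j q : (q <= k)%N -> exists SC : {set X} * (X -> {set Y}),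
   [/\ SC.1 \subset XL i, #|XL i|%:R - d <= #|SC.1|%:R,
      forall x, x \in SC.1 ->
        [/\ #|SC.2 x| = q, SC.2 x \subset YL j & forall y, y \in SC.2 x -> f x y] &
      forall x x' y, x \in SC.1 -> x' \in SC.1 -> y \in SC.2 x -> y \in SC.2 x' ->
         x = x'].
  move=> qk; have [|S [C hSC]] := @star_packing R X Y f (XL i) (YL j) q d.
  - apply: (@hall_of_layers R X Y f (XL i) (YL j) k q v kap inv D1 D2) => //.
    + by rewrite addr_ge0.
    + move=> A' /fintype.subsetP sA; rewrite -sum1_card natr_sum mulr_suml.
      apply: (@le_trans _ _ (\sum_(x in A') (\sum_(y in YL j) v x y + eX j x))).
        apply: ler_sum => x _; rewrite mul1r.
        have := le_add_sqr_div (inv - \sum_(y in YL j) v x y) eta0.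
        rewrite /eX -[(_ - inv) ^+ 2]sqrrN opprB.
        have -> : \sum_y v x y * (ly y == Some j)%:R = \sum_(y in YL j) v x y.
          rewrite [RHS]big_mkcond /=; apply: eq_bigr => y _; rewrite inE.
          by case: (_ == _); rewrite ?mulr1 ?mulr0.
        by lra.
      rewrite big_split /= lerD2l /D1 (bigD1 j) //= ler_wpDr //.
        by apply: sumr_ge0 => ? _; apply: sumr_ge0.
      rewrite [leLHS]big_mkcond [leRHS]big_mkcond /=; apply: ler_sum => x _.
      case: ifP => [/sA|_]; last by case: ifP.
      by rewrite inE => /andP[-> _].
    + move=> N _; rewrite -sum1_card natr_sum mulr_suml.
      apply: (@le_trans _ _ (\sum_(y in N) (inv / k%:R + eY i y))).
        apply: ler_sum => y _.
        have := le_add_sqr_div (\sum_x v x y * (lx x == Some i)%:R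
                   - inv * \sum_x phi x * v x y) eta0; rewrite -/(eY i y).
        have : \sum_(x in XL i) v x y <= \sum_x v x y * (lx x == Some i)%:R.
          rewrite [leLHS]big_mkcond /=; apply: ler_sum => x _; rewrite inE.
          by case: (_ == Some i); rewrite ?andbF ?andbT ?mulr1 ?mulr0 //; case: ifP.
        have : inv * \sum_x phi x * v x y <= inv / k%:R by rewrite ler_wpM2l ?(ltW inv0).
        by lra.
      rewrite big_split /= mul1r lerD2l /D2 (bigD1 i) //= ler_wpDr //.
        by apply: sumr_ge0 => ? _; apply: sumr_ge0.
      by rewrite [leLHS]big_mkcond /=; apply: ler_sum => y _; case: ifP.
  - by exists (S, C).
(* [c i] packs stars from layer i into layer i, and [p i] matches layer i
   into the previous layer; layer 0 has no previous layer and is given up. *)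
have /fin_all_exists [c hc] := fun i => pack i i k (leqnn k).
have /fin_all_exists [p hp] := fun i : 'I_l.+1 => pack i (inord i.-1) 1%N k0.
pose A := [set x | if lx x is Some i then [&& i != ord0, x \in (c i).1 & x \in (p i).1]
                   else false].
pose C x := if lx x is Some i then (c i).2 x else finset.set0.
pose P x := if lx x is Some i then odflt y0 [pick y in (p i).2 x] else y0.
exists A, C, P, (fun x => if lx x is Some i then val i else 0%N),
  (fun y => if ly y is Some i then val i else 0%N).
have predlt (i : 'I_l.+1) : (i.-1 < l.+1)%N by apply: leq_ltn_trans (leq_pred _) _.
have gt0 (i : 'I_l.+1) : i != ord0 -> (0 < i)%N by rewrite lt0n.
have inA x : x \in A -> exists i, [/\ lx x = Some i, i != ord0, x \in (c i).1,
     x \in (p i).1 & P x \in (p i).2 x].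
  rewrite inE /P; case: (lx x) => // i /and3P[i0 xc xp]; exists i; split=> //.
  case: pickP => //= h; have [_ _ hpi _] := hp i; have [h1 _ _] := hpi x xp.
  by move: h1; rewrite (eq_card0 h).
split; first split.
- move=> x /inA[i [lxi _ xc xp xP]]; rewrite /C lxi.
  have [_ _ hci _] := hc i; have [? _ hfi] := hci x xc.
  by have [_ _ hpi _] := hp i; have [_ _ hpf] := hpi x xp; split=> //; apply: hpf.
- move=> x x' y /inA[i [lxi _ xc _ _]] /inA[j [lxj _ xc' _ _]]; rewrite /C lxi lxj.
  have [_ _ hci hdi] := hc i; have [_ /fintype.subsetP ci _] := hci x xc.
  have [_ _ hcj _] := hc j; have [_ /fintype.subsetP cj _] := hcj x' xc'.
  move=> yi yj; have := ci _ yi; have := cj _ yj; rewrite !inE => /eqP -> /eqP [ij].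
  by subst j; apply: hdi yi yj.
- move=> x x' /inA[i [lxi i0 _ xp xP]] /inA[j [lxj j0 _ xp' xP']] PP.
  have [_ _ hpi hdi] := hp i; have [_ /fintype.subsetP pi _] := hpi x xp.
  have [_ _ hpj _] := hp j; have [_ /fintype.subsetP pj _] := hpj x' xp'.
  have := pi _ xP; have := pj _ xP'; rewrite PP !inE => /eqP -> /eqP [].
  move=> /(congr1 val) /=; rewrite !inordK // => ij.
  have {}ij : i = j.
    by apply: val_inj; rewrite /= -(prednK (gt0 _ i0)) -(prednK (gt0 _ j0)) ij.
  subst j; have xP2 : P x \in (p i).2 x' by rewrite PP.
  exact: (hdi _ _ _ xp xp' xP xP2).
- move=> x /inA[i [lxi i0 _ xp xP]]; rewrite lxi.
  have [_ _ hpi _] := hp i; have [_ /fintype.subsetP pi _] := hpi x xp.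
  by have := pi _ xP; rewrite inE => /eqP -> /=; rewrite inordK // prednK // gt0.
- move=> x y /inA[i [lxi _ xc _ _]]; rewrite /C lxi.
  have [_ _ hci _] := hc i; have [_ /fintype.subsetP ci _] := hci x xc.
  by move=> /ci; rewrite inE => /eqP ->.
have XLE i : \sum_(x | phi x != 0) (lx x == Some i)%:R = #|XL i|%:R :> R.
  rewrite -sum1_card natr_sum big_mkcond [RHS]big_mkcond /=; apply: eq_bigr => x _.
  by rewrite inE; case: (phi x != 0); case: (_ == _).
under eq_bigr do rewrite XLE.
have cardA : \sum_(i < l.+1 | i != ord0) #|(c i).1 :&: (p i).1|%:R <= #|A|%:R :> R.
  under eq_bigr do rewrite -sum1_card natr_sum big_mkcond /=.
  rewrite exchange_big -sum1_card natr_sum [leRHS]big_mkcond /=.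
  apply: ler_sum => x _; rewrite inE.
  have out i : lx x != Some i -> x \notin (c i).1.
    move=> h; have [/fintype.subsetP sc _ _ _] := hc i.
    by apply/negP => /sc; rewrite inE (negbTE h) andbF.
  case E: (lx x) => [i|]; last first.
    by rewrite big1 // => i _; rewrite inE (negbTE (out i _)) // E.
  rewrite big_mkcond (bigD1 i) //= big1 ?addr0 ?inE => [|j ji].
    by case: (i != ord0); case: (x \in _); case: (x \in _).
  rewrite inE (negbTE (out j _)) ?if_same // E.
  by apply: contraNneq ji => -[->].
apply: le_trans cardA.
apply: (@le_trans _ _ (\sum_(i < l.+1 | i != ord0) (#|XL i|%:R - 2 * d))); last first.
  apply: ler_sum => i _; have [s1 n1 _ _] := hc i; have [s2 n2 _ _] := hp i.
  have : (#|(c i).1| + #|(p i).1| <= #|XL i| + #|(c i).1 :&: (p i).1|)%N.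
    by rewrite -cardsUI leq_add2r subset_leq_card // finset.subUset s1 s2.
  rewrite -(ler_nat R) !natrD; lra.
rewrite sumrB lerD2l lerN2 sumr_const -[_ *+ #|_|]mulr_natl.
have -> : #|(fun i : 'I_l.+1 => i != ord0)| = l.
  by rewrite -[RHS]/(l.+1.-1) -[X in _ = X.-1]card_ord -(cardC1 (@ord0 l)).
have -> : 2 * k%:R * l.+1%:R ^+ 2 * (D1 + D2) = l.+1%:R * (2 * d).
  by rewrite /d /inv; field; rewrite nat1r gt_eqF.
by rewrite ler_wpM2r ?ler_nat // /d !mulr_ge0 ?addr_ge0 ?invr_ge0 // ltW.
Qed.

(** A subgraph with degrees at most k M and M is a fractional packing of stars
    with k leaves in which every edge has weight at most 1/M. When M is large
    the packing can be made integral, with a parent for each star, at the cost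
    of a small proportion of the vertices. *)
Lemma forest_of_flow (R : archiRealFieldType) (k : nat) (eps : R) :
  (0 < k)%N -> 0 < eps ->
  exists M0 : nat, forall M : nat, (M0 <= M)%N ->
  forall (X Y : finType) (y0 : Y) (f : X -> Y -> bool),
  (forall x, \sum_y f x y <= k * M)%N -> (forall y, \sum_x f x y <= M)%N ->
  exists A C P mx my, forest_in k f A C P mx my /\
    (\sum_x \sum_y f x y)%:R / (k * M)%:R - eps * (#|X|%:R + #|Y|%:R)
      <= #|A|%:R :> R.
Proof.
move=> k0 eps0.
have k0R : 0 < k%:R :> R by rewrite ltr0n.
pose l := Num.truncn (4 / eps).
have l0 : 0 < l.+1%:R :> R by rewrite ltr0n.
set inv : R := l.+1%:R^-1.
have inv0 : 0 < inv by rewrite invr_gt0.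
have inv1 : inv <= 1 by rewrite invf_le1 // ler1n.
have invE : inv <= eps / 4.
  rewrite /inv -[eps / 4]invrK lef_pV2 ?posrE ?invr_gt0 ?divr_gt0 // invf_div.
  exact/ltW/truncnS_gt.
(* Vertices that carry less than a proportion theta of their capacity are
   dropped, since the weights are divided by that proportion. *)
pose theta : R := eps / 4.
have th0 : 0 < theta by rewrite divr_gt0.
pose W : R := 2 * k%:R * l.+1%:R ^+ 2.
have W0 : 0 < W by rewrite !(mulr_gt0, exprn_gt0).
pose eta : R := eps / (4 * W * l.+1%:R).
have eta0 : 0 < eta by rewrite divr_gt0 // !mulr_gt0.
pose M0 := maxn 1 (maxn (Num.truncn (k%:R * theta * eta ^+ 2)^-1).+1
                 (Num.truncn (theta * inv)^-1).+1).
exists M0 => M hM X Y y0 f hrow hcol.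
have M1 : (0 < M)%N by apply: leq_trans hM; rewrite leq_maxl.
have M0R : 0 < M%:R :> R by rewrite ltr0n.
have kM0 : 0 < (k * M)%:R :> R by rewrite ltr0n muln_gt0 k0.
pose kap : R := ((k * M)%:R * theta)^-1.
have kap0 : 0 < kap by rewrite invr_gt0 mulr_gt0.
have kap_eta : kap <= eta ^+ 2.
  have c0 : 0 < k%:R * theta * eta ^+ 2.
    by apply: mulr_gt0; [exact: mulr_gt0 | exact: exprn_gt0].
  have : (k%:R * theta * eta ^+ 2)^-1 <= M%:R.
    apply: ltW; apply: lt_le_trans (truncnS_gt _) _.
    by rewrite ler_nat (leq_trans _ hM) // !leq_max leqnn orbT.
  rewrite -(ler_pM2l c0) mulfV ?gt_eqF // => h.
  rewrite /kap natrM -div1r ler_pdivrMr ?mulr_gt0 //; lra.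
have kap_inv : k%:R * kap <= inv.
  have c0 : 0 < theta * inv by rewrite mulr_gt0.
  have : (theta * inv)^-1 <= M%:R.
    apply: ltW; apply: lt_le_trans (truncnS_gt _) _.
    by rewrite ler_nat (leq_trans _ hM) // !leq_max leqnn !orbT.
  rewrite -(ler_pM2l c0) mulfV ?gt_eqF // => h.
  have -> : k%:R * kap = (M%:R * theta)^-1 by rewrite /kap natrM; field; rewrite !gt_eqF.
  by rewrite -div1r ler_pdivrMr ?mulr_gt0 //; lra.
pose row x : R := (\sum_y f x y)%:R.
have row0 x : 0 <= row x by rewrite ler0n.
pose phi0 x := row x / (k * M)%:R.
have phi00 x : 0 <= phi0 x by rewrite divr_ge0 // ler0n.
have phi01 x : phi0 x <= 1 by rewrite ler_pdivrMr // mul1r ler_nat.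
pose phi x := if theta <= phi0 x then phi0 x else 0.
pose v x y := if theta <= phi0 x then (f x y)%:R / row x else 0.
have row_gt x : theta <= phi0 x -> kap^-1 <= row x.
  by rewrite ler_pdivlMr // /kap invrK mulrC.
have row_gt0 x : theta <= phi0 x -> 0 < row x.
  by move=> /row_gt; apply: lt_le_trans; rewrite invr_gt0.
have hphi x : 0 <= phi x <= 1.
  by rewrite /phi; case: ifP; rewrite ?phi00 ?phi01 // lexx ler01.
have hv x y : 0 <= v x y <= kap * (f x y)%:R.
  rewrite /v; case: ifP => [h|_]; last by rewrite lexx mulr_ge0 ?ler0n // ltW.
  rewrite divr_ge0 ?ler0n // mulrC ler_wpM2r ?ler0n //.
  by rewrite -[kap]invrK lef_pV2 ?posrE ?row_gt ?row_gt0 // invr_gt0.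
have hv1 x : phi x != 0 -> \sum_y v x y = 1.
  rewrite /phi /v; case: ifP => [h _|_]; last by rewrite eqxx.
  by rewrite -mulr_suml -natr_sum -/(row x) mulfV // gt_eqF // row_gt0.
have hcolv y : \sum_x phi x * v x y <= k%:R^-1.
  apply: (@le_trans _ _ (\sum_x (f x y)%:R / (k * M)%:R)).
    apply: ler_sum => x _; rewrite /phi /v; case: ifP => [h|_]; last first.
      by rewrite mul0r divr_ge0 // ler0n.
    rewrite le_eqVlt /phi0; apply/orP; left; apply/eqP.
    by field; rewrite !gt_eqF // ?row_gt0.
  rewrite -mulr_suml -natr_sum ler_pdivrMr // natrM mulrA mulVf ?gt_eqF // mul1r.
  by rewrite ler_nat.
have hv' x y : 0 <= v x y <= kap.
  have /andP[-> h] := hv x y; rewrite (le_trans h) //.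
  by case: (f x y); rewrite ?mulr1 ?mulr0 // ltW.
have hcolv1 y : \sum_x phi x * v x y <= 1.
  by apply: le_trans (hcolv y) _; rewrite invf_le1 // ler1n.
have kapb : 0 <= kap <= eta ^+ 2 by rewrite ltW.
have [lx [ly h1]] := @random_layers R X Y l phi v eta kap W eta0 (ltW W0) kapb
  hphi hv' hv1 hcolv1.
have phi_ge0 x : 0 <= phi x by case/andP: (hphi x).
have [A [C [P [mx [my [hF h2]]]]]] := @forest_of_layers R X Y y0 l k phi f v eta kap
  lx ly k0 eta0 phi_ge0 hv kap_inv hcolv.
exists A, C, P, mx, my; split=> //.
apply: le_trans h2; apply: le_trans h1.
have -> : W * (2 * eta * l.+1%:R * (#|X|%:R + #|Y|%:R))
     = eps / 2 * (#|X|%:R + #|Y|%:R).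
  by rewrite /eta; field; rewrite !gt_eqF // nat1r.
have sphi0 : (\sum_x \sum_y f x y)%:R / (k * M)%:R = \sum_x phi0 x.
  by rewrite natr_sum mulr_suml.
have sphi : \sum_x phi0 x - theta * #|X|%:R <= \sum_x phi x.
  rewrite -sum1_card natr_sum mulr_sumr -sumrB; apply: ler_sum => x _.
  rewrite /phi mulr1; case: ifP => [_|/negbT]; first by rewrite gerBl ltW.
  by rewrite -ltNge; lra.
have sphiX : \sum_x phi x <= #|X|%:R.
  by rewrite -sum1_card natr_sum; apply: ler_sum => x _; case/andP: (hphi x).
have sphi00 : 0 <= \sum_x phi x by apply: sumr_ge0.
have hinv : inv * \sum_x phi x <= eps / 4 * #|X|%:R.
  by rewrite ler_pM // ltW.
have epsY : 0 <= eps * #|Y|%:R by rewrite mulr_ge0 ?ler0n // ltW.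
rewrite sphi0 mulrBl mul1r /inv -/inv; move: sphi; rewrite /theta; lra.
Qed.

(** * Forests in a graph on the natural numbers, or an obstruction *)

(** The same forests as [forest_in], in a graph e on the natural numbers: the
    centres are vertices of {1, ..., n} outside K, their neighbours are in K. *)
Record nat_forest (k : nat) (e : rel nat) (K : pred nat) (n : nat) (A : seq nat)
    (C : nat -> 'I_k -> nat) (P lx ly : nat -> nat) : Prop := {
  nf_uniq : uniq A;
  nf_dom : forall x, x \in A -> (0 < x <= n)%N && ~~ K x;
  nf_par : forall x, x \in A -> K (P x) && e x (P x);
  nf_child : forall x j, x \in A -> K (C x j) && e x (C x j);
  nf_child_inj : forall x x' j j', x \in A -> x' \in A -> C x j = C x' j' ->
    x = x' /\ j = j';
  nf_par_inj : forall x x', x \in A -> x' \in A -> P x = P x' -> x = x';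
  nf_par_layer : forall x, x \in A -> (ly (P x)).+1 = lx x;
  nf_child_layer : forall x j, x \in A -> ly (C x j) = lx x }.

Lemma nat_forest_of_ord (k n N : nat) (e : rel nat) (K : pred nat)
    (f : 'I_N.+1 -> 'I_N.+1 -> bool) (A : {set 'I_N.+1}) C P mx my :
  (0 < k)%N ->
  (forall x y : 'I_N.+1, f x y -> [&& (0 < x <= n)%N, ~~ K x, K y & e x y]) ->
  forest_in k f A C P mx my ->
  exists A' C' P' lx ly, @nat_forest k e K n A' C' P' lx ly /\ size A' = #|A|.
Proof.
move=> k0 hf [h1 h2 h3 h4 h5].
pose s x := enum (C x).
have ss x : x \in A -> size (s x) = k.
  by move=> /h1[<- _ _]; rewrite /s cardE.
pose y0 : 'I_N.+1 := ord0.
have sin x (j : 'I_k) : x \in A -> nth y0 (s x) j \in C x.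
  by move=> xA; rewrite -mem_enum mem_nth // ss.
have inA (x : nat) : x \in [seq val z | z <- enum A] ->
    exists z : 'I_N.+1, [/\ z \in A, x = val z & inord x = z].
  by move=> /mapP[z]; rewrite mem_enum => zA ->; exists z; rewrite inord_val.
exists [seq val z | z <- enum A], (fun x j => val (nth y0 (s (inord x)) j)),
  (fun x => val (P (inord x))), (fun x => mx (inord x)), (fun y => my (inord y)).
split; last by rewrite size_map cardE.
split.
- by rewrite map_inj_uniq ?enum_uniq //; exact: val_inj.
- move=> _ /inA[x [xA -> _]]; have [_ fP _] := h1 x xA.
  by have /and4P[-> ->] := hf _ _ fP.
- move=> _ /inA[x [xA -> ->]]; have [_ fP _] := h1 x xA.
  by have /and4P[_ _ -> ->] := hf _ _ fP.
- move=> _ j /inA[x [xA -> ->]]; have [_ _ fC] := h1 x xA.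
  by have /and4P[_ _ -> ->] := hf _ _ (fC _ (sin x j xA)).
- move=> _ _ j j' /inA[x [xA -> ->]] /inA[x' [x'A -> ->]] /val_inj E.
  have xx' : x = x'.
    by apply: (h2 _ _ _ xA x'A (sin x j xA)); rewrite E; exact: sin.
  subst x'; split=> //; move/eqP: E; rewrite nth_uniq ?enum_uniq ?ss //.
  by move=> /eqP/val_inj.
- by move=> _ _ /inA[x [xA -> ->]] /inA[x' [x'A -> ->]] /val_inj /(h3 _ _ xA x'A) ->.
- by move=> _ /inA[x [xA -> ->]]; rewrite inord_val h4.
- by move=> _ j /inA[x [xA -> ->]]; rewrite inord_val (h5 x) // sin.
Qed.

(** The two cases of max-flow min-cut for edges of capacity 1 between the
    vertices of {1, ..., n} outside K and the vertices of K up to q n. A large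
    flow yields a forest by [forest_of_flow], and a small cut is an obstruction.
    As all vertex capacities are at most a small multiple of n, a minimum cut
    contains at most zeta n^2 edges. *)
Lemma forest_or_obstruction (R : archiRealFieldType) (k q : nat) (eps zeta : R) :
  (0 < k)%N -> (0 < q)%N -> 0 < eps -> 0 < zeta ->
  exists n0 : nat, forall (e : rel nat) (K : pred nat) (n : nat) (delta : R),
  (n0 <= n)%N -> 0 <= delta ->
  (exists A C P lx ly, @nat_forest k e K n A C P lx ly /\
     (count (predC K) (iota 1 n))%:R - (delta + eps) * n%:R <= (size A)%:R) \/
  (exists I N : seq nat, [/\ uniq I && uniq N,
     forall x, x \in I -> (0 < x <= n)%N && ~~ K x, forall y, y \in N -> K y,
     delta * n%:R <= (size I)%:R - (size N)%:R / k%:R &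
     (\sum_(x <- I) \sum_(0 <= y < (q * n).+1 | K y && (y \notin N)) e x y)%:R
       <= zeta * n%:R ^+ 2]).
Proof.
move=> k0 q0 eps0 zeta0.
have k0R : 0 < k%:R :> R by rewrite ltr0n.
pose eps' : R := eps / (2 * q.+1%:R).
have eps'0 : 0 < eps' by rewrite divr_gt0 // mulr_gt0 // ltr0n.
have [M0 hM0] := forest_of_flow k0 eps'0.
pose r := (Num.truncn (2 * k%:R / zeta)).+1.
have r0 : 0 < r%:R :> R by rewrite ltr0n.
have hr : 2 * k%:R <= zeta * r%:R.
  by rewrite [leRHS]mulrC -ler_pdivrMr // ltW // truncnS_gt.
exists (maxn 1 (maxn r (r * M0))) => e K n delta; rewrite !geq_max.
move=> /and3P[n1 nr nM] delta0.
have n0R : 0 < n%:R :> R by rewrite ltr0n.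
(* The capacity M is a small multiple of n: large enough for the layering,
   small enough for the k M n edges that can cross a minimum cut to be few. *)
pose M := (n %/ r).+1.
have M0M : (M0 <= M)%N by rewrite /M ltnW // ltnS leq_divRL // mulnC.
have MM : k%:R * M%:R * n%:R <= zeta * n%:R ^+ 2.
  rewrite expr2 mulrA ler_wpM2r ?(ltW n0R) // /M -natr1 mulrDr mulr1.
  have h1 : r%:R <= n%:R :> R by rewrite ler_nat.
  have h2 : (n %/ r)%:R * r%:R <= n%:R :> R by rewrite -natrM ler_nat leq_trunc_div.
  have h3 : k%:R * 2 <= zeta * n%:R.
    by rewrite mulrC; apply: le_trans hr _; rewrite ler_wpM2l // ltW.
  suff h4 : k%:R * (n %/ r)%:R * 2 <= zeta * n%:R by lra.
  have h5 : 2 * k%:R * (n %/ r)%:R <= zeta * r%:R * (n %/ r)%:R by rewrite ler_wpM2r.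
  have h6 : zeta * ((n %/ r)%:R * r%:R) <= zeta * n%:R by rewrite ler_wpM2l // ltW.
  lra.
have kM0 : 0 < (k * M)%:R :> R by rewrite ltr0n muln_gt0 k0.
pose N := (q * n)%N.
have nN : (n <= N)%N by rewrite leq_pmull.
pose X (x : 'I_N.+1) := (0 < x <= n)%N && ~~ K x.
pose E (x y : 'I_N.+1) := [&& (0 < x <= n)%N, ~~ K x, K y & e x y].
have EX x y : E x y = [&& X x, K y & e x y] by rewrite /E /X; case: (0 < x <= n)%N.
have [f [I [S [fE fa fb fcut]]]] := max_flow_min_cut
  (fun x : 'I_N.+1 => X x * (k * M))%N (fun y : 'I_N.+1 => K y * M)%N
  (fun x y => nat_of_bool (E x y)).
pose fb' x y := (0 < f x y)%N.
have ff x y : nat_of_bool (fb' x y) = f x y.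
  by have := fE x y; rewrite /fb'; case: (f x y) (E x y) => [|[|m]] [].
have nXE : #|[set x | X x]| = count (predC K) (iota 1 n).
  rewrite -size_filter cardE -(size_map val); apply/perm_size/uniq_perm.
  - by rewrite map_inj_uniq ?enum_uniq //; exact: val_inj.
  - by rewrite filter_uniq ?iota_uniq.
  move=> x; rewrite mem_filter mem_iota add1n ltnS; apply/mapP/idP => [[z]|].
    by rewrite mem_enum inE => /andP[h Kz] ->; rewrite /= Kz.
  move=> /andP[Kx xn]; have xN : (x < N.+1)%N.
    by case/andP: xn => _ xn; rewrite ltnS (leq_trans xn nN).
  by exists (Ordinal xN) => //; rewrite mem_enum inE /X /= xn.
pose I' := [seq val x | x <- enum [set x in I | X x]].
pose S' := [seq val y | y <- enum [set y in S | K y]].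
have inS' (y : 'I_N.+1) : (val y \in S') = (y \in S) && K y.
  by rewrite mem_map ?mem_enum ?inE //; exact: val_inj.
pose t := (\sum_(x <- I') \sum_(0 <= y < (q * n).+1 | K y && (y \notin S')) e x y)%N.
have tE : t = (\sum_x \sum_y (x \in I) * (y \notin S) * E x y)%N.
  rewrite /t big_map big_enum /= [LHS]big_mkcond /=; apply: eq_bigr => x _.
  rewrite big_mkord inE; case xI: (x \in I) => /=; last by rewrite big1.
  case Xx: (X x); last by rewrite big1 // => y _; rewrite EX Xx muln0.
  rewrite [LHS]big_mkcond /=; apply: eq_bigr => y _; rewrite inS' EX Xx /=.
  by case: (y \in S); case: (K y); case: (e x y).
have cutE : (k * M * #|[set x | X x]| + M * size S' + t
    <= \sum_x \sum_y f x y + k * M * size I')%N.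
  have EI : (\sum_x (x \notin I) * (X x * (k * M)) + k * M * size I' = k * M * #|[set x | X x]|)%N.
    rewrite size_map -cardE -!sum1_card !big_distrr /= !(big_mkcond (fun x => x \in _)) /=.
    rewrite -big_split /=; apply: eq_bigr => x _; rewrite !inE.
    by case: (x \in I); case: (X x); rewrite /= ?(mul0n, mul1n, muln0, muln1, addn0, add0n).
  have ES : (\sum_y (y \in S) * (K y * M) = M * size S')%N.
    rewrite size_map -cardE -!sum1_card !big_distrr /= !(big_mkcond (fun x => x \in _)) /=.
    apply: eq_bigr => x _; rewrite !inE.
    by case: (x \in S); case: (K x); rewrite /= ?(mul0n, mul1n, muln0, muln1).
  move: fcut; rewrite /cut -tE ES -EI.
  by rewrite !(addnAC _ (k * M * size I')%N) leq_add2r.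
(* [D] is the deficit of the minimum cut, counted in vertices. *)
pose D : R := (size I')%:R - (size S')%:R / k%:R - t%:R / (k * M)%:R.
have flow_ge : (k * M)%:R * (#|[set x | X x]|%:R - D) <= (\sum_x \sum_y f x y)%N%:R.
  have -> : (k * M)%:R * (#|[set x | X x]|%:R - D)
    = (k * M)%:R * #|[set x | X x]|%:R + M%:R * (size S')%:R + t%:R - (k * M)%:R * (size I')%:R.
    by rewrite /D natrM; field; rewrite !gt_eqF // nat1r.
  by rewrite lerBlDr -!natrM -!natrD ler_nat.
have [Dle|Dgt] := leP D (delta * n%:R); [left|right].
  have [||A [C [P [mx [my [hF hA]]]]]] := hM0 M M0M _ _ ord0 fb'.
  - move=> x; under eq_bigr do rewrite ff; apply: leq_trans (fa x) _.
    by case: (X x); rewrite ?mul1n.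
  - move=> y; under eq_bigr do rewrite ff; apply: leq_trans (fb y) _.
    by case: (K y); rewrite ?mul1n.
  have [|A' [C' [P' [lx [ly [hF' sA']]]]]] := @nat_forest_of_ord k n N e K fb' A C P mx my k0 _ hF.
    move=> x y; rewrite /fb' -/(E x y) => fxy; have := fE x y.
    by case: (E x y) => //; case: (f x y) fxy.
  exists A', C', P', lx, ly; split=> //; rewrite sA'; apply: le_trans hA.
  rewrite -nXE card_ord.
  under [X in (X)%:R / _]eq_bigr => x _ do under eq_bigr => y _ do rewrite ff.
  have h1 : #|[set x | X x]|%:R - D <= (\sum_x \sum_y f x y)%N%:R / (k * M)%:R.
    by rewrite ler_pdivlMr // mulrC.
  have h2 : eps' * (N.+1%:R + N.+1%:R) <= eps * n%:R.
    have -> : eps * n%:R = eps' * (2 * (q.+1%:R * n%:R)).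
      by rewrite /eps'; field; rewrite gt_eqF // nat1r.
    rewrite ler_wpM2l ?(ltW eps'0) // -natrM -natrD -[2]/(2%:R) -natrM ler_nat.
    by rewrite addnn -mul2n leq_mul2l /= mulSn -[(q * n).+1]add1n leq_add2r.
  lra.
have t0 : 0 <= t%:R / (k * M)%:R :> R by rewrite divr_ge0 // ltW.
exists I', S'; split.
- by rewrite !map_inj_uniq ?enum_uniq //; exact: val_inj.
- by move=> z /mapP[x]; rewrite mem_enum inE => /andP[_ Xx] ->.
- by move=> z /mapP[y]; rewrite mem_enum inE => /andP[_ Ky] ->.
- by move: Dgt; rewrite /D; lra.
rewrite -/t; apply: le_trans MM.
have D0 : 0 <= D by apply: le_trans (ltW Dgt); rewrite mulr_ge0 // ltW.
have S0 : 0 <= (size S')%:R / k%:R :> R by rewrite divr_ge0.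
have In : (size I')%:R <= n%:R :> R.
  rewrite ler_nat; have -> : n = size (iota 1 n) by rewrite size_iota.
  apply: uniq_leq_size; first by rewrite map_inj_uniq ?enum_uniq //; exact: val_inj.
  move=> z /mapP[x]; rewrite mem_enum inE => /andP[_ /andP[xn _]] ->.
  by rewrite mem_iota add1n ltnS.
have : t%:R / (k * M)%:R <= n%:R :> R by move: D0; rewrite /D; lra.
by rewrite ler_pdivrMr // natrM mulrC.
Qed.

(** * Growing an infinite tree inside one colour *)

Local Open Scope nat_scope.

Section TreeGrowth.
Variables (k : nat) (e : rel nat) (K : pred nat).
Hypothesis k_gt0 : 0 < k.
Hypothesis e_sym : symmetric e.
Hypothesis K_pos : forall v, K v -> 0 < v.
Hypothesis K_infinite : forall m, exists2 v, m < v & K v.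
Hypothesis K_joined : forall (s : seq nat) m, all K s ->
  exists2 w, m < w & all (e w) s.

(** A finite forest under construction; [None] marks a child slot that is still
    open. *)
Definition children_map := nat -> 'I_k -> option nat.

Definition walk (ch : children_map) (r : nat) (p : seq 'I_k) : option nat :=
  foldl (fun o i => obind (ch^~ i) o) (Some r) p.

Lemma walk_rcons ch r p i : walk ch r (rcons p i) = obind (ch^~ i) (walk ch r p).
Proof. by rewrite /walk -cats1 foldl_cat. Qed.

Lemma walk_cat ch r p q u : walk ch r p = Some u -> walk ch r (p ++ q) = walk ch u q.
Proof. by rewrite /walk foldl_cat => ->. Qed.

Definition reach ch r v := exists p, walk ch r p = Some v.

Lemma reach_refl ch r : reach ch r r. Proof. by exists [::]. Qed.

Lemma reach_step ch r u i v : reach ch r u -> ch u i = Some v -> reach ch r v.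
Proof. by move=> [p hp] h; exists (rcons p i); rewrite walk_rcons hp /= h. Qed.

Lemma reach_trans ch r u v : reach ch r u -> reach ch u v -> reach ch r v.
Proof. by move=> [p hp] [q hq]; exists (p ++ q); rewrite (walk_cat _ hp). Qed.

Definition extends (ch ch' : children_map) :=
  forall v i w, ch v i = Some w -> ch' v i = Some w.

Lemma extends_refl ch : extends ch ch. Proof. by []. Qed.
Hint Resolve extends_refl : core.

Lemma walk_extends ch ch' r p v :
  extends ch ch' -> walk ch r p = Some v -> walk ch' r p = Some v.
Proof.
move=> hx; elim/last_ind: p v => [//|p i IH] v; rewrite !walk_rcons.
by case E: (walk ch r p) => [u|//] /=; rewrite (IH u E); apply: hx.
Qed.

Lemma reach_extends ch ch' r v : extends ch ch' -> reach ch r v -> reach ch' r v.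
Proof. by move=> hx [p hp]; exists p; apply: walk_extends hp. Qed.

(** V is the set of vertices used so far and rs lists the roots. The only
    vertices allowed to have open slots are those of K, because these can be
    extended by means of [K_joined]. *)
Record forest_state (V : seq nat) (ch : children_map) (rs : seq nat) : Prop := {
  fs_dom : forall v i w, ch v i = Some w -> (v \in V) && (w \in V);
  fs_inj : forall v i v' i' w, ch v i = Some w -> ch v' i' = Some w ->
    v = v' /\ i = i';
  fs_edge : forall v i w, ch v i = Some w -> e v w;
  fs_open : forall v i, v \in V -> ch v i = None -> K v;
  fs_pos : forall v, v \in V -> 0 < v;
  fs_root : forall r, r \in rs -> [/\ r \in V, K r & forall v i, ch v i <> Some r];
  fs_uniq : uniq rs;
  fs_reach : forall v, v \in V -> exists2 r, r \in rs & reach ch r v }.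

(** Addresses are unique because the children map is injective and the root is
    nobody's child. *)
Lemma walk_inj V ch r rs p q v : forest_state V ch (r :: rs) ->
  walk ch r p = Some v -> walk ch r q = Some v -> p = q.
Proof.
move=> fs; have [_ _ nr] := fs_root fs (mem_head r rs).
elim/last_ind: p q v => [|p i IH] q v.
  case/lastP: q => [//|q j] [<-]; rewrite walk_rcons.
  by case: (walk ch r q) => //= u /nr.
case/lastP: q => [|q j]; rewrite !walk_rcons.
  by case: (walk ch r p) => //= u h [E]; case: (nr u i); rewrite h E.
case Ep: (walk ch r p) => [u|//] /=; case Eq: (walk ch r q) => [u'|//] /= h h'.
have [Eu Ei] := fs_inj fs h h'; subst u' j.
by rewrite (IH _ _ Ep Eq).
Qed.

(** The component of the root is finite, hence not the full infinite tree. *)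
Lemma open_slot V ch r rs : forest_state V ch (r :: rs) ->
  exists u i, reach ch r u /\ ch u i = None.
Proof.
move=> fs; apply: contrapT => hno.
pose i0 := Ordinal k_gt0.
(* Otherwise the path of first children never stops, but V is finite. *)
have full n : exists v, walk ch r (nseq n i0) = Some v.
  elim: n => [|n [v hv]]; first by exists r.
  rewrite -addn1 nseqD cats1; case E: (ch v i0) => [w|].
    by exists w; rewrite walk_rcons hv.
  by case: hno; exists v, i0; split=> //; exists (nseq n i0).
have /choice [g hg] := full.
have gV n : g n \in V.
  case: n (hg n) => [|n] /=; first by case=> <-; have [] := fs_root fs (mem_head r rs).
  rewrite -[_ :: _]/(nseq n.+1 i0) -addn1 nseqD cats1 walk_rcons.
  by case: (walk _ _ _) => //= u /(fs_dom fs)/andP[].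
have ginj : injective g.
  move=> m n E; have := hg n; rewrite -E => /(walk_inj fs (hg m)).
  by move=> /(congr1 size); rewrite !size_nseq.
have := uniq_leq_size (s1 := map g (iota 0 (size V).+1)) (s2 := V).
rewrite map_inj_uniq // iota_uniq size_map size_iota ltnn => /(_ isT) h.
suff : false by []; apply: h.
by move=> _ /mapP[n _ ->].
Qed.

Definition bound (V : seq nat) := \max_(v <- V) v.

Lemma bound_notin V w : bound V < w -> w \notin V.
Proof.
move=> h; apply/negP => wV.
by have := @leq_bigmax_seq _ V xpredT id w wV isT; rewrite leqNgt h.
Qed.

Lemma fresh_seq (V : seq nat) n :
  exists s, [/\ size s = n, uniq s, all K s & forall v, v \in s -> v \notin V].
Proof.
elim: n => [|n [s [h1 h2 h3 h4]]]; first by exists [::].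
have [v hv Kv] := K_infinite (bound (s ++ V)).
have := bound_notin hv; rewrite mem_cat negb_or => /andP[vs vV].
exists (v :: s); split=> /=; rewrite ?h1 ?vs ?Kv // => u.
by rewrite inE => /orP[/eqP ->|/h4].
Qed.

(** A late vertex w joined to u, to r and to k - 1 further fresh vertices of K
    becomes the child of u, with those k vertices as its children. Thus w, which
    may be outside K, has no open slot. *)
Lemma connect_root V ch r0 r rs u i :
  forest_state V ch (r0 :: r :: rs) -> reach ch r0 u -> u \in V -> ch u i = None ->
  exists V' ch', [/\ forest_state V' ch' (r0 :: rs), {subset V <= V'},
    extends ch ch' & ch' u i <> None].
Proof.
move=> fs ru uV ui.
have [rV Kr nr] : [/\ r \in V, K r & forall v i, ch v i <> Some r].
  by apply: (fs_root fs); rewrite !inE eqxx orbT.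
have [s [sz_s us Ks fr_s]] := fresh_seq V k.-1.
pose ys := r :: s.
have sz_ys : size ys = k by rewrite /= sz_s prednK.
have uys : uniq ys by rewrite /= us andbT; apply/negP => /fr_s; rewrite rV.
have Ku : K u by apply: (fs_open fs) ui.
have Kall : all K (u :: ys) by rewrite /= Ku Kr.
have [w hw ew] := K_joined (bound (ys ++ V)) Kall.
have := bound_notin hw; rewrite mem_cat negb_or => /andP[wys wV].
have euw : e u w by rewrite e_sym; case/andP: ew.
have ewys y : y \in ys -> e w y.
  by move: ew => /= /and3P[_ h1 /allP h2]; rewrite inE => /orP[/eqP ->|/h2].
pose y (j : 'I_k) := nth 0 ys j.
have yin j : y j \in ys by rewrite mem_nth // sz_ys.
have yinj j j' : y j = y j' -> j = j'.
  by move=> /eqP; rewrite nth_uniq ?sz_ys // => /eqP/val_inj.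
pose ch' v j := if v == w then Some (y j)
                else if (v == u) && (j == i) then Some w else ch v j.
have wu : u != w by apply: contraNneq wV => <-.
have hx : extends ch ch'.
  move=> v j z h; rewrite /ch'; have /andP[vV _] := fs_dom fs h.
  rewrite (_ : v == w = false); last by apply: contraNF wV => /eqP <-.
  by case: ifP => // /andP[/eqP E /eqP E']; move: ui; rewrite -E -E' h.
have ys_out v j z : ch v j = Some z -> z \notin ys.
  move=> h; rewrite inE negb_or; apply/andP; split.
    by apply/eqP => E; apply: (nr v j); rewrite -E.
  by have /andP[_ zV] := fs_dom fs h; apply/negP => /fr_s; rewrite zV.
pose V' := w :: s ++ V.
have VV' : {subset V <= V'} by move=> v vV; rewrite inE mem_cat vV !orbT.
have ysV' z : z \in ys -> z \in V'.
  by rewrite inE => /orP[/eqP ->|h]; [exact: VV'|rewrite inE mem_cat h orbT].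
have rw : reach ch' r0 w.
  by apply: (@reach_step _ _ u i); [exact: reach_extends ru|rewrite /ch' (negbTE wu) !eqxx].
have rys z : z \in ys -> reach ch' r0 z.
  move=> zy; have zk : index z ys < k by rewrite -sz_ys index_mem.
  apply: (@reach_step _ _ w (Ordinal zk)) => //.
  by rewrite /ch' eqxx /y nth_index.
exists V', ch'; split=> //; last by rewrite /ch' (negbTE wu) !eqxx.
split.
- move=> v j z; rewrite /ch'; case: eqP => [-> [<-]|_].
    by rewrite (ysV' (y j)) // inE eqxx.
  case: ifP => [/andP[/eqP -> _] [<-]|_ h]; first by rewrite VV' // inE eqxx.
  by have /andP[? ?] := fs_dom fs h; rewrite !VV'.
- have nw v j : ch v j <> Some w.
    by move=> h; have /andP[_] := fs_dom fs h; rewrite (negbTE wV).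
  move=> v j v' j' z; rewrite /ch'; case: (eqVneq v w) => [->|vw].
    case=> <-; case: (eqVneq v' w) => [-> [/yinj ->] //|_].
    case: ifP => [_ [E]|_ h]; first by move: (yin j); rewrite -E (negbTE wys).
    by have := ys_out _ _ _ h; rewrite yin.
  case: ifP => [/andP[/eqP -> /eqP ->] [<-]|_ h].
    case: (eqVneq v' w) => [_ [E]|_]; first by move: (yin j'); rewrite E (negbTE wys).
    by case: ifP => [/andP[/eqP -> /eqP ->] //|_ /nw].
  case: (eqVneq v' w) => [_ [E]|_].
    by have := ys_out _ _ _ h; rewrite -E yin.
  case: ifP => [_ [E]|_]; first by move: h; rewrite -E => /nw.
  exact: (fs_inj fs h).
- move=> v j z; rewrite /ch'; case: eqP => [-> [<-]|_]; first exact: ewys.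
  by case: ifP => [/andP[/eqP -> _] [<-] //|_]; apply: (fs_edge fs).
- move=> v j; rewrite /ch' inE mem_cat; case: eqP => //= _ /orP[vs _|vV].
    by move/allP: Ks => /(_ v vs).
  by case: ifP => // _; apply: (fs_open fs).
- move=> v; rewrite inE mem_cat => /or3P[/eqP ->|vs|vV]; first exact: leq_ltn_trans hw.
    by apply: K_pos; move/allP: Ks => /(_ v vs).
  exact: (fs_pos fs).
- move=> z zr; have [|zV Kz nz] := fs_root fs (r := z).
    by move: zr; rewrite !inE => /orP[->|->] //; rewrite !orbT.
  split; [exact: VV'|exact: Kz|move=> v j; rewrite /ch'].
  case: eqP => [_ [E]|_]; last first.
    case: ifP => [_ [E]|_]; last exact: nz.
    by move: wV; rewrite E zV.
  have := yin j; rewrite E inE => /orP[/eqP zE|/fr_s]; last by rewrite zV.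
  have := fs_uniq fs; rewrite /= !inE -zE; move: zr; rewrite inE.
  by case: (z =P r0) => [-> |_] /=; [rewrite eqxx|move=> ->; rewrite andbF].
- by have := fs_uniq fs; rewrite /= inE negb_or => /and3P[/andP[_ ->] _ ->].
- move=> v; rewrite inE mem_cat => /or3P[/eqP ->|vs|vV].
  + by exists r0; rewrite ?inE ?eqxx.
  + by exists r0; rewrite ?inE ?eqxx //; apply: rys; rewrite inE vs orbT.
  + have [z zr /(reach_extends hx) hz] := fs_reach fs vV.
    move: zr; rewrite !inE => /or3P[/eqP zE|/eqP zE|zr].
    * by exists r0; rewrite ?inE ?eqxx // -zE.
    * exists r0; rewrite ?inE ?eqxx //; apply: reach_trans hz.
      by rewrite zE; apply: rys; rewrite inE eqxx.
    * by exists z; rewrite // inE zr orbT.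
Qed.

Lemma reach_in V ch rs r v : forest_state V ch rs -> r \in V -> reach ch r v -> v \in V.
Proof.
move=> fs rV [p]; elim/last_ind: p v => [|p i _] v; first by case=> <-.
by rewrite walk_rcons; case: (walk ch r p) => //= u /(fs_dom fs)/andP[].
Qed.

Lemma connect_all V ch r0 rs : forest_state V ch (r0 :: rs) ->
  exists V' ch', [/\ forest_state V' ch' [:: r0], {subset V <= V'} & extends ch ch'].
Proof.
elim: rs V ch => [|r rs IH] V ch fs; first by exists V, ch; split=> //.
have [u [i [ru ui]]] := open_slot fs.
have [r0V _ _] := fs_root fs (mem_head r0 _).
have [V1 [ch1 [fs1 s1 x1 _]]] := connect_root fs ru (reach_in fs r0V ru) ui.
have [V2 [ch2 [fs2 s2 x2]]] := IH _ _ fs1.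
by exists V2, ch2; split=> // [v /s1/s2|v j w /x1/x2].
Qed.

Lemma add_root V ch r0 v : forest_state V ch [:: r0] -> K v -> v \notin V ->
  forest_state (v :: V) ch [:: r0; v].
Proof.
move=> fs Kv vV; have [r0V Kr0 nr0] := fs_root fs (mem_head r0 _).
split.
- by move=> u i w /(fs_dom fs)/andP[uV wV]; rewrite !inE uV wV !orbT.
- exact: (fs_inj fs).
- exact: (fs_edge fs).
- by move=> u i; rewrite inE => /orP[/eqP -> //|]; apply: (fs_open fs).
- by move=> u; rewrite inE => /orP[/eqP ->|]; [exact: K_pos|apply: (fs_pos fs)].
- move=> r; rewrite !inE => /orP[/eqP ->|/eqP ->]; first by rewrite r0V orbT.
  by rewrite eqxx; split=> // u i /(fs_dom fs)/andP[_]; rewrite (negbTE vV).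
- by rewrite /= mem_seq1 andbT; apply: contraNneq vV => <-.
- move=> u; rewrite inE => /orP[/eqP ->|/(fs_reach fs)[r]].
    by exists v; [rewrite !inE eqxx orbT|exact: reach_refl].
  by rewrite inE => /eqP -> h; exists r0; rewrite ?mem_head.
Qed.

Lemma absorb V ch r0 (s : seq nat) : forest_state V ch [:: r0] -> all K s ->
  exists V' ch', [/\ forest_state V' ch' [:: r0], {subset V <= V'}, extends ch ch' &
    {subset s <= V'}].
Proof.
elim: s V ch => [|v s IH] V ch fs; first by exists V, ch; split=> //.
move=> /= /andP[Kv Ks]; have [vV|vV] := boolP (v \in V).
  have [V' [ch' [h1 h2 h3 h4]]] := IH V ch fs Ks; exists V', ch'; split=> // u.
  by rewrite inE => /orP[/eqP -> |/h4 //]; apply: h2.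
have [V1 [ch1 [fs1 s1 x1]]] := connect_all (add_root fs Kv vV).
have [V' [ch' [h1 h2 h3 h4]]] := IH V1 ch1 fs1 Ks; exists V', ch'; split=> //.
- by move=> u uV; apply/h2/s1; rewrite inE uV orbT.
- by move=> u i w /x1/h3.
- by move=> u; rewrite inE => /orP[/eqP ->|/h4 //]; apply/h2/s1; rewrite mem_head.
Qed.

Lemma fill_word V ch r0 (p : seq 'I_k) : forest_state V ch [:: r0] ->
  exists V' ch', [/\ forest_state V' ch' [:: r0], {subset V <= V'}, extends ch ch' &
    exists v, walk ch' r0 p = Some v].
Proof.
move=> fs; elim/last_ind: p => [|p i [V1 [ch1 [fs1 s1 x1 [u hu]]]]].
  by exists V, ch; split=> //; exists r0.
case E: (ch1 u i) => [v|].
  by exists V1, ch1; split=> //; exists v; rewrite walk_rcons hu.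
have [v vb Kv] := K_infinite (bound V1).
have ru : reach ch1 r0 u by exists p.
have uV : u \in V1 by apply: (reach_in fs1 _ ru); have [] := fs_root fs1 (mem_head r0 _).
have [|V2 [ch2 [fs2 s2 x2 hui]]] :=
  connect_root (add_root fs1 Kv (bound_notin vb)) ru _ E; first by rewrite inE uV orbT.
exists V2, ch2; split=> //.
- by move=> z /s1 zV; apply: s2; rewrite inE zV orbT.
- by move=> z j w /x1/x2.
- case E2: (ch2 u i) hui => [w|//] _; exists w.
  by rewrite walk_rcons (walk_extends x2 hu).
Qed.

(** The stars are added all at once, without regard to the tree. Every
    component has its root in K and is connected to the tree afterwards. *)
Lemma insert_forest V ch r0 (A : seq nat) (C : nat -> 'I_k -> nat)
    (P lx ly : nat -> nat) :
  forest_state V ch [:: r0] ->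
  (forall x, x \in A -> [/\ 0 < x, ~~ K x & x \notin V]) ->
  (forall x, x \in A -> [/\ P x \notin V, K (P x) & e (P x) x]) ->
  (forall x j, x \in A -> [/\ C x j \notin V, K (C x j) & e x (C x j)]) ->
  (forall x x' j j', x \in A -> x' \in A -> C x j = C x' j' -> x = x' /\ j = j') ->
  (forall x x', x \in A -> x' \in A -> P x = P x' -> x = x') ->
  (forall x, x \in A -> (ly (P x)).+1 = lx x) ->
  (forall x j, x \in A -> ly (C x j) = lx x) ->
  exists V' ch', [/\ forest_state V' ch' [:: r0], {subset V <= V'}, extends ch ch' &
    {subset A <= V'}].
Proof.
move=> fs hA hP hC injC injP layP layC.
have [r0V Kr0 nr0] := fs_root fs (mem_head r0 _).
pose i0 := Ordinal k_gt0.
(* The forest uses the first child slot of the parent of each x in A. *)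
pose par_of v := ohead [seq x <- A | P x == v].
have par_ofP v x : par_of v = Some x -> x \in A /\ P x = v.
  rewrite /par_of; case E: [seq x <- A | P x == v] => [//|z s] [<-].
  have : z \in [seq x <- A | P x == v] by rewrite E mem_head.
  by rewrite mem_filter => /andP[/eqP].
have par_ofE x : x \in A -> par_of (P x) = Some x.
  move=> xA; case E: (par_of (P x)) => [z|].
    by have [zA hz] := par_ofP _ _ E; rewrite (injP _ _ zA xA hz).
  move: E; rewrite /par_of; have : x \in [seq z <- A | P z == P x].
    by rewrite mem_filter eqxx.
  by case: [seq _ <- _ | _].
pose ch1 v i := if v \in A then Some (C v i)
  else if i == i0 then (if par_of v is Some x then Some x else ch v i) else ch v i.
have ch1P v i w : ch1 v i = Some w ->
   [\/ v \in A /\ w = C v i, [/\ w \in A, v = P w & i = i0] | ch v i = Some w].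
  rewrite /ch1; case: ifP => [vA [<-]|_]; first by constructor 1.
  case: eqP => [->|_]; last by constructor 3.
  case E: (par_of v) => [x|]; last by constructor 3.
  by case=> <-; have [? ?] := par_ofP _ _ E; constructor 2.
have inA_K x : x \in A -> K x = false by move=> /hA[_ /negbTE].
have C_A x j : x \in A -> C x j \in A = false.
  move=> xA; apply/negP => /inA_K; by have [_ -> _] := hC x j xA.
have P_A x : x \in A -> P x \in A = false.
  move=> xA; apply/negP => /inA_K; by have [_ -> _] := hP x xA.
have ch1P' x : x \in A -> ch1 (P x) i0 = Some x.
  by move=> xA; rewrite /ch1 P_A // eqxx par_ofE.
have ch1C x j : x \in A -> ch1 x j = Some (C x j) by rewrite /ch1 => ->.
have x1 : extends ch ch1.
  move=> v i w h; have /andP[vV _] := fs_dom fs h.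
  rewrite /ch1; case: ifP => [/hA[_ _]|_]; first by rewrite vV.
  case: ifP => // _; case E: (par_of v) => [x|//].
  by have [xA hx] := par_ofP _ _ E; have [] := hP x xA; rewrite hx vV.
pose rs := [seq y <- undup (map P A) | all (fun x => all (fun j => C x j != y) (enum 'I_k)) A].
pose V1 := V ++ A ++ map P A ++ flatten [seq [seq C x j | j <- enum 'I_k] | x <- A].
have AV1 x : x \in A -> x \in V1 by move=> h; rewrite !mem_cat h !orbT.
have PV1 x : x \in A -> P x \in V1 by move=> h; rewrite !mem_cat map_f ?orbT.
have CV1 x j : x \in A -> C x j \in V1.
  move=> h; rewrite !mem_cat; apply/orP; right; apply/orP; right; apply/orP; right.
  by apply/flatten_mapP; exists x => //; apply: map_f; rewrite mem_enum.
have V1P v : v \in V1 -> [\/ v \in V, v \in A, exists2 x, x \in A & v = P x |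
    exists x j, x \in A /\ v = C x j].
  rewrite !mem_cat => /or4P[?|?|/mapP[x xA ->]|/flatten_mapP[x xA /mapP[j _ ->]]].
  - by constructor 1.
  - by constructor 2.
  - by constructor 3; exists x.
  - by constructor 4; exists x, j.
have VV1 v : v \in V -> v \in V1 by move=> h; rewrite mem_cat h.
have rsP y : y \in rs -> exists2 x, x \in A & y = P x.
  by rewrite mem_filter mem_undup => /andP[_ /mapP].
pose R v := exists2 r, r \in r0 :: rs & reach ch1 r v.
(* Climbing from x through its ancestors in the forest lowers the layer, so it
   ends at a root. *)
have RP x : x \in A -> (forall x', x' \in A -> lx x' < lx x -> R x') -> R (P x).
  move=> xA IH; have [yrs|] := boolP (P x \in rs).
    by exists (P x); [rewrite inE yrs orbT|exact: reach_refl].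
  rewrite mem_filter mem_undup map_f // andbT => /allPn[x' x'A /allPn[j _]].
  rewrite negbK => /eqP E.
  have [r rr hr] : R x' by apply: IH => //; rewrite -(layC x' j) // E -layP.
  by exists r => //; apply: (reach_step hr (i := j)); rewrite ch1C // E.
have RA x : x \in A -> R x.
  have [n] := ubnP (lx x); elim: n x => // n IH x; rewrite ltnS => hn xA.
  have [|r rr hr] := RP x xA.
    by move=> x' x'A lt; apply: IH => //; apply: leq_trans lt hn.
  by exists r => //; apply: reach_step hr (ch1P' x xA).
have fs1 : forest_state V1 ch1 (r0 :: rs).
  split.
  - move=> v i w /ch1P[[vA ->]|[wA -> _]|/(fs_dom fs)/andP[vV wV]].
    + by rewrite AV1 // CV1.
    + by rewrite PV1 // (AV1 w).
    + by rewrite !VV1.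
  - move=> v i v' i' w /ch1P[[vA wE]|[wA vE iE]|h] /ch1P[[vA' wE']|[wA' vE' iE']|h'].
    + by apply: injC; rewrite -?wE -?wE'.
    + by move: wA'; rewrite wE C_A.
    + have /andP[_] := fs_dom fs h'; have [] := hC v i vA.
      by rewrite -wE => /negbTE ->.
    + by move: wA; rewrite wE' C_A.
    + by rewrite vE vE' iE iE'.
    + by have /andP[_] := fs_dom fs h'; have [_ _ /negbTE ->] := hA w wA.
    + have /andP[_] := fs_dom fs h; have [] := hC v' i' vA'.
      by rewrite -wE' => /negbTE ->.
    + by have /andP[_] := fs_dom fs h; have [_ _ /negbTE ->] := hA w wA'.
    + exact: (fs_inj fs h).
  - move=> v i w /ch1P[[vA ->]|[wA -> _]|]; last exact: (fs_edge fs).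
    + by have [] := hC v i vA.
    + by have [] := hP w wA.
  - move=> v i /V1P[vV|vA|[x xA ->] _|[x [j [xA ->]]] _].
    + rewrite /ch1; case: ifP => // _; case: ifP => _; last exact: (fs_open fs).
      by case: (par_of v) => [//|h]; exact: (fs_open fs vV h).
    + by rewrite ch1C.
    + by have [] := hP x xA.
    + by have [] := hC x j xA.
  - move=> v /V1P[vV|vA|[x xA ->]|[x [j [xA ->]]]].
    + exact: (fs_pos fs).
    + by have [] := hA v vA.
    + by apply: K_pos; have [] := hP x xA.
    + by apply: K_pos; have [] := hC x j xA.
  - move=> r; rewrite inE => /orP[/eqP ->|rrs].
      split=> //; first exact: VV1.
      move=> v i /ch1P[[vA E]|[wA _ _]|]; last exact: nr0.
        by have [/negP h _ _] := hC v i vA; case: h; rewrite -E.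
      by move: Kr0; rewrite inA_K.
    have [x xA rE] := rsP r rrs; have [PV KP _] := hP x xA.
    split; rewrite ?rE ?PV1 // => v i /ch1P[[vA E]|[wA _ _]|h].
    + move: rrs; rewrite mem_filter => /andP[/allP/(_ v vA)/allP/(_ i)].
      by rewrite mem_enum rE E eqxx => /(_ isT).
    + by move: KP; rewrite inA_K.
    + by have /andP[_] := fs_dom fs h; rewrite (negbTE PV).
  - rewrite /= filter_uniq ?undup_uniq // andbT; apply/negP => /rsP[x xA rE].
    by have [/negP h _ _] := hP x xA; case: h; rewrite -rE.
  - move=> v /V1P[vV|vA|[x xA ->]|[x [j [xA ->]]]].
    + have [r] := fs_reach fs vV; rewrite inE => /eqP -> h.
      by exists r0; [rewrite mem_head|exact: reach_extends h].
    + exact: RA.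
    + by apply: RP => // x' x'A _; apply: RA.
    + by have [r rr hr] := RA x xA; exists r => //; apply: reach_step hr (ch1C x j xA).
have [V2 [ch2 [fs2 s2 x2]]] := connect_all fs1.
exists V2, ch2; split=> //.
- by move=> v /VV1/s2.
- by move=> v i w /x1/x2.
- by move=> v /AV1/s2.
Qed.

(** The limit of a sequence of stages. Each stage fills the slots along one more
    word, so that in the limit no slot is open, and performs one of the required
    extensions Q j. *)
Lemma tree_of_stages (Q : nat -> seq nat -> Prop) :
  (forall V ch r0 j, forest_state V ch [:: r0] -> exists V' ch',
     [/\ forest_state V' ch' [:: r0], {subset V <= V'}, extends ch ch' & Q j V']) ->
  exists phi : seq 'I_k -> nat,
  [/\ injective phi, forall p, 0 < phi p, forall p i, e (phi p) (phi (rcons p i)) &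
      forall j, exists V, Q j V /\ forall v, v \in V -> exists p, phi p = v].
Proof.
move=> step.
have [r0 _ Kr0] := K_infinite 0.
pose state := (seq nat * children_map)%type.
pose good (s : state) := forest_state s.1 s.2 [:: r0].
pose s0 : state := ([:: r0], fun _ _ => None).
have good0 : good s0.
  split=> //=.
  - by move=> v i; rewrite mem_seq1 => /eqP ->.
  - by move=> v; rewrite mem_seq1 => /eqP ->; apply: K_pos.
  - by move=> r; rewrite mem_seq1 => /eqP ->; split=> //; apply: mem_head.
  - move=> v; rewrite mem_seq1 => /eqP ->; exists r0; rewrite ?mem_head //.
    exact: reach_refl.
pose next (js : nat * state) (s' : state) := good js.2 -> 
  [/\ good s', {subset js.2.1 <= s'.1}, extends js.2.2 s'.2, Q js.1 s'.1 &
      forall p, choice.unpickle js.1 = Some p -> exists v, walk s'.2 r0 p = Some v].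
have /choice[nx hnx] : forall js, exists s', next js s'.
  move=> [j s]; rewrite /next /=.
  case: (pselect (good s)) => [gs|ng]; last by exists s0.
  have fill : exists V1 ch1, [/\ forest_state V1 ch1 [:: r0], {subset s.1 <= V1},
      extends s.2 ch1 & forall p, choice.unpickle j = Some p -> exists v, walk ch1 r0 p = Some v].
    case: (choice.unpickle j) => [p|]; last by exists s.1, s.2; split=> //.
    have [V1 [ch1 [h1 h2 h3 h4]]] := fill_word p gs.
    by exists V1, ch1; split=> // _ [<-].
  have [V1 [ch1 [fs1 s1 x1 w1]]] := fill.
  have [V2 [ch2 [fs2 s2 x2 q2]]] := step V1 ch1 r0 j fs1.
  exists (V2, ch2) => _; split=> //=.
  - by move=> v /s1/s2.
  - by move=> v i w /x1/x2.
  - by move=> p /w1[v hv]; exists v; apply: walk_extends hv.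
pose st := fix st n := if n is m.+1 then nx (m, st m) else s0.
have st_good n : good (st n).
  by elim: n => [|n IH] //=; have [] := hnx (n, st n) IH.
have st_next n := hnx (n, st n) (st_good n).
have st_ext m n : m <= n -> extends (st m).2 (st n).2.
  elim: n => [|n IH]; first by rewrite leqn0 => /eqP -> v i w.
  rewrite leq_eqVlt => /orP[/eqP -> v i w //|]; rewrite ltnS => /IH h v i w /h.
  by have [_ _ h' _ _] := st_next n; apply: h'.
have st_walk p : exists v, walk (st (choice.pickle p).+1).2 r0 p = Some v.
  have [_ _ _ _ h] := st_next (choice.pickle p); apply: h.
  exact: choice.pickleK.
have /choice[phi hphi] := st_walk.
have phi_walk n p v : walk (st n).2 r0 p = Some v -> phi p = v.
  move=> h; have := walk_extends (st_ext _ _ (leq_maxl n (choice.pickle p).+1)) h.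
  by rewrite (walk_extends (st_ext _ _ (leq_maxr n (choice.pickle p).+1)) (hphi p)) => -[].
have walk_late n p : choice.pickle p < n -> walk (st n).2 r0 p = Some (phi p).
  by move=> h; apply: walk_extends (hphi p); apply: st_ext.
exists phi; split.
- move=> p q E; pose n := (maxn (choice.pickle p) (choice.pickle q)).+1.
  have hp : walk (st n).2 r0 p = Some (phi p) by apply: walk_late; rewrite ltnS leq_maxl.
  apply: (walk_inj (st_good n) hp).
  by rewrite E; apply: walk_late; rewrite ltnS leq_maxr.
- move=> p; apply: (fs_pos (st_good (choice.pickle p).+1)).
  apply: (reach_in (st_good _) (r := r0)); last by exists p.
  by have [] := fs_root (st_good (choice.pickle p).+1) (mem_head r0 _).
- move=> p i; pose n := (maxn (choice.pickle p) (choice.pickle (rcons p i))).+1.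
  have hp : walk (st n).2 r0 p = Some (phi p) by apply: walk_late; rewrite ltnS leq_maxl.
  have := walk_late n (rcons p i); rewrite ltnS leq_maxr walk_rcons hp /= => /(_ isT).
  exact: (fs_edge (st_good n)).
- move=> j; exists (st j.+1).1; have [g _ _ q _] := st_next j; split=> // v vV.
  have [r] := fs_reach g vV; rewrite inE => /eqP -> [p hp].
  by exists p; exact: (phi_walk j.+1 p v hp).
Qed.
End TreeGrowth.

(** * The functions Gamma and the constant h *)

Import numFieldNormedType.Exports.
Local Open Scope classical_set_scope.
Local Open Scope ring_scope.

Section RateFunctions.
Variable R : realType.
Implicit Types (g : R -> R) (gamma t x y : R).

(** Being 1-Lipschitz on the nonnegative half-line, the domain of the functions
    in the definition of [hfun]. *)
Definition short_map g := forall x y, 0 <= x -> 0 <= y -> `|g x - g y| <= `|x - y|.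

Lemma short_mapP g : 1.-lipschitz_(`[0%R, +oo[) (g : R -> R) <-> short_map g.
Proof.
split=> [h x y x0 y0|h].
  by have := h (x, y); rewrite /= mul1r; apply; split=> /=; rewrite in_itv /= andbT.
move=> [x y] [/=]; rewrite !in_itv /= !andbT => x0 y0; rewrite mul1r; exact: h.
Qed.

Lemma short_map_opp g : short_map g -> short_map (fun x => - g x).
Proof. by move=> h x y x0 y0; rewrite -opprD normrN; apply: h. Qed.

Lemma emin_spec (A : set R) :
  (emin A = +oo%E) \/ exists x, [/\ emin A = x%:E, A x & lbound A x].
Proof.
rewrite /emin; case: xgetP => [_ _ [x [Ax lx] <-]|_]; last by left.
by right; exists x.
Qed.

Lemma emin_eq (A : set R) x : A x -> lbound A x -> emin A = x%:E.
Proof.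
move=> Ax lx; rewrite /emin; apply: xget_unique; first by exists x.
move=> _ [y [Ay ly] <-]; congr (_%:E); apply: le_anti.
by rewrite ly // lx.
Qed.

(** The minimum in the definition of Gamma exists whenever the set is nonempty,
    since g is continuous. *)
Lemma Gamma_le gamma g t x : short_map g -> 0 <= x -> t <= gamma * x + g x ->
  exists y, [/\ Gamma_plus gamma g t = y%:E, 0 <= y & y <= x].
Proof.
move=> hg x0 hx; set A := [set x | 0 <= x /\ t <= gamma * x + g x].
have Ax : A x by [].
have lb0 : lbound A 0 by move=> ? [].
have hA : has_inf A by split; [exists x|exists 0].
pose m := inf A.
have m0 : 0 <= m by apply: lb_le_inf => //; exists x.
have mx : m <= x by apply: ge_inf => //; exists 0.
have lm : lbound A m by move=> y Ay; apply: ge_inf => //; exists 0.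
exists m; split=> //; apply: emin_eq => //; split=> //.
apply/ler_addgt0Pl => eps eps0.
pose d := eps / (`|gamma| + 1).
have d0 : 0 < d by rewrite divr_gt0 // ltr_wpDl.
have [a [a0 ha] lta] := inf_adherent d0 hA.
have ma : m <= a by apply: lm.
rewrite -/m in lta.
have h1 : gamma * (a - m) <= `|gamma| * (a - m) by rewrite ler_wpM2r ?subr_ge0 // ler_norm.
have h2 : g a - g m <= a - m.
  apply: le_trans (ler_norm _) _; apply: le_trans (hg a m a0 m0) _.
  by rewrite ger0_norm ?subr_ge0.
have h3 : `|gamma| * (a - m) <= `|gamma| * d by rewrite ler_wpM2l //; lra.
have : `|gamma| * d + d = eps.
  by rewrite /d; field; rewrite gt_eqF // ltr_wpDl.
by rewrite mulrBr in h1; lra.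
Qed.

(** At the minimum the inequality is an equality: at x = 0 the left-hand side is
    below t, and it varies continuously. *)
Lemma Gamma_spec gamma g t : short_map g -> g 0 = 0 -> 0 < t ->
  Gamma_plus gamma g t = +oo%E \/
  exists x, [/\ Gamma_plus gamma g t = x%:E, 0 <= x & gamma * x + g x = t].
Proof.
move=> hg g0 t0; have [?|[x [E [x0 hx] lx]]] := emin_spec [set x | 0 <= x /\ t <= gamma * x + g x].
  by left.
right; exists x; split=> //; apply: le_anti; rewrite hx andbT leNgt.
apply/negP => hlt.
have xp : 0 < x.
  by rewrite lt_neqAle x0 andbT; apply: contraTneq hlt => <-; rewrite g0; lra.
pose d := Num.min x ((gamma * x + g x - t) / (`|gamma| + 1)).
have d0 : 0 < d by rewrite lt_min xp divr_gt0 ?subr_gt0 // ltr_wpDl.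
have dx : d <= x by rewrite ge_min lexx.
have hd : d * (`|gamma| + 1) <= gamma * x + g x - t.
  by rewrite -ler_pdivlMr ?ltr_wpDl // ge_min lexx orbT.
have xd0 : 0 <= x - d by rewrite subr_ge0.
suff : x <= x - d by lra.
apply: lx; split=> //.
have := hg x (x - d) x0 xd0; rewrite (_ : x - (x - d) = d); last by ring.
rewrite (@ger0_norm _ d) ?(ltW d0) // ler_norml => /andP[_ h].
have : gamma * d <= `|gamma| * d by rewrite ler_wpM2r ?(ltW d0) // ler_norm.
rewrite mulrBr; lra.
Qed.

Lemma Gamma_plus_mono gamma g t t' x x' : t <= t' ->
  Gamma_plus gamma g t = x%:E -> Gamma_plus gamma g t' = x'%:E -> x <= x'.
Proof.
rewrite /Gamma_plus => tt'.
have [->|[y [-> _ ly]]] // := emin_spec [set x | 0 <= x /\ t <= gamma * x + g x].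
have [->|[y' [-> [y'0 hy'] _]]] // := emin_spec [set x | 0 <= x /\ t' <= gamma * x + g x].
by move=> [<-] [<-]; apply: ly; split=> //; apply: le_trans hy'.
Qed.

Lemma Gamma_plus_ge0 gamma g t : (0 <= Gamma_plus gamma g t)%E.
Proof.
have [h|[y [h [y0 _] _]]] := emin_spec [set x | 0 <= x /\ t <= gamma * x + g x].
  by rewrite /Gamma_plus h.
by rewrite /Gamma_plus h lee_fin.
Qed.

Lemma Gamma_minusE gamma g t : Gamma_minus gamma g t = Gamma_plus gamma (fun x => - g x) t.
Proof. by []. Qed.

Definition rate gamma g t : \bar R :=
  ((Gamma_plus gamma g t + Gamma_minus gamma g t) * (t^-1)%:E)%E.

Lemma hfun_le gamma g (M : R) : short_map g -> g 0 = 0 ->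
  (\forall t \near +oo, (rate gamma g t <= M%:E)%E) -> (hfun gamma <= M%:E)%E.
Proof.
move=> hg g0 hM.
apply: (@le_trans _ _ (limf_esup (rate gamma g) (pinfty_nbhs R))).
  apply: ereal_inf_lbound; exists g => //; split=> //; exact/short_mapP.
rewrite limf_esupE.
apply: (@le_trans _ _ (ereal_sup (rate gamma g @` [set t | (rate gamma g t <= M%:E)%E]))).
  by apply: ereal_inf_lbound; exists [set t | (rate gamma g t <= M%:E)%E].
by apply: ge_ereal_sup => _ [t ht <-].
Qed.

Lemma hfun_approx gamma (h M : R) : hfun gamma = h%:E -> h < M ->
  exists g, [/\ short_map g, g 0 = 0 & \forall t \near +oo, (rate gamma g t <= M%:E)%E].
Proof.
move=> hE hM.
have [|_ [g [/short_mapP hg g0] <-]] := @ereal_inf_lt _ _ M%:E (_ : hfun gamma < M%:E)%E.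
  by rewrite hE lte_fin.
rewrite limf_esupE => /ereal_inf_lt[_ [V hV <-] hlt].
exists g; split=> //; apply: filterS hV => t Vt.
by apply: le_trans (ltW hlt); apply: ereal_sup_ubound; exists t.
Qed.

Lemma hfun_ge0 gamma : (0 <= hfun gamma)%E.
Proof.
apply: le_ereal_inf_tmp => _ [g _ <-]; rewrite limf_esupE.
apply: le_ereal_inf_tmp => _ [V hV <-].
have [t [Vt t0]] : exists t, V t /\ 0 < t.
  have /filter_ex[t [? ?]] : \forall t \near +oo, V t /\ 0 < t.
    by near=> t; split; [near: t|near: t; exact: nbhs_pinfty_gt].
  by exists t.
apply: le_trans (ereal_sup_ubound _); last by exists t.
by rewrite mule_ge0 ?adde_ge0 ?Gamma_plus_ge0 // lee_fin invr_ge0 ltW.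
Unshelve. all: by end_near. Qed.

(** A largest 1-Lipschitz function below the points (x n, p n) and vanishing at
    0 is the lower envelope of |z| and of p n + |z - x n|. It is above the points
    (y m, q m) because none of the cones with apex (x n, p n), or (0, 0), passes
    below them. *)
Lemma lipschitz_separation (x p y q : nat -> R) :
  (forall n, 0 <= x n) -> (forall n, - p n <= x n) -> (forall n, q n <= y n) ->
  (forall m n, q m - p n <= `|x n - y m|) ->
  exists g, [/\ short_map g, g 0 = 0, forall n, g (x n) <= p n & forall m, q m <= g (y m)].
Proof.
move=> x0 hp hq hpq.
pose S z := `|z| |` range (fun n => p n + `|z - x n|).
have lbS z : lbound (S z) (- `|z|).
  move=> _ [->|[n _ <-]]; first by have := normr_ge0 z; lra.
  have := hp n; have := ler_normD (x n - z) z; rewrite subrK (ger0_norm (x0 n)).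
  by rewrite distrC; lra.
have hS z : has_inf (S z) by split; [exists `|z|; left|exists (- `|z|)].
pose g z := inf (S z).
have gle z u : S z u -> g z <= u by move=> h; apply: ge_inf => //; case: (hS z).
have leg z u : lbound (S z) u -> u <= g z by apply: lb_le_inf; case: (hS z).
have glip a b : g a <= g b + `|a - b|.
  rewrite -lerBlDr; apply: leg => _ [->|[n _ <-]]; rewrite lerBlDr.
    apply: (@le_trans _ _ `|a|); first by apply: gle; left.
    by have := ler_normD b (a - b); rewrite addrC subrK addrC.
  apply: (@le_trans _ _ (p n + `|a - x n|)); first by apply: gle; right; exists n.
  by rewrite -addrA lerD2l addrC; have := ler_normD (a - b) (b - x n); rewrite subrKA.
exists g; split.
- move=> a b _ _; rewrite ler_norml; have := glip a b; have := glip b a.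
  by rewrite (distrC b a); lra.
- apply: le_anti; apply/andP; split; first by apply: gle; left; rewrite normr0.
  apply: leg => _ [->|[n _ <-]]; first by rewrite normr0.
  by rewrite sub0r normrN ger0_norm //; have := hp n; lra.
- by move=> n; apply: gle; right; exists n => //; rewrite subrr normr0 addr0.
- move=> m; apply: leg => _ [->|[n _ <-]].
    exact: le_trans (hq m) (ler_norm _).
  by have := hpq m n; rewrite distrC; lra.
Qed.
End RateFunctions.

Lemma rate_le (R : realType) (gamma t x y M : R) (g : R -> R) :
  short_map g -> 0 < t -> 0 <= x -> t <= gamma * x - g x ->
  0 <= y -> t <= gamma * y + g y -> x + y <= M * t ->
  (rate gamma g t <= M%:E)%E.
Proof.
move=> hg t0 x0 hx y0 hy hM.
have [x' [Ex x'0 xx]] := Gamma_le (short_map_opp hg) x0 hx.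
have [y' [Ey y'0 yy]] := Gamma_le hg y0 hy.
rewrite /rate Gamma_minusE Ex Ey -EFinD -EFinM lee_fin ler_pdivrMr //; lra.
Qed.

(** For the constant to be finite some admissible g must keep both Gamma_plus
    and Gamma_minus linear in t. When gamma is 0 this forces g to oscillate. *)
Lemma hfun_fin (R : realType) (gamma : R) : 0 <= gamma ->
  exists2 h : R, hfun gamma = h%:E & 0 <= h.
Proof.
move=> gamma0.
have pos n : 0 < 16 ^+ n :> R by rewrite exprn_gt0.
(* A zigzag between slopes of both signs: it is at most -x/2 at the points
   x = 2 * 16^n and at least x/2 at the points x = 8 * 16^n. *)
have [|||m n|g [hg g0 hP hQ]] := @lipschitz_separation R (fun n => 2 * 16 ^+ n)
  (fun n => - 16 ^+ n) (fun n => 8 * 16 ^+ n) (fun n => 4 * 16 ^+ n).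
- by move=> n; have := pos n; lra.
- by move=> n; have := pos n; lra.
- by move=> n; have := pos n; lra.
- have [mn|nm] := leqP n m.
    have h : 16 ^+ n <= 16 ^+ m :> R by rewrite ler_weXn2l // ler1n.
    by rewrite distrC; apply: le_trans (ler_norm _); have := pos m; lra.
  have h : 16 ^+ m.+1 <= 16 ^+ n :> R by rewrite ler_weXn2l // ler1n.
  by move: h; rewrite exprS => h; apply: le_trans (ler_norm _); have := pos m; lra.
have hM : (hfun gamma <= 160%:E)%E.
  apply: (hfun_le hg g0); near=> t.
  have t1 : 1 < t by near: t; exact: nbhs_pinfty_gt.
  have ex : exists n, t <= 16 ^+ n.
    exists (Num.truncn t).+1; apply: ltW; apply: lt_le_trans (truncnS_gt _) _.
    by rewrite -natrX ler_nat ltnW // ltn_expl.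
  have [n hn nmin] := ex_minnP ex.
  have n16 : 16 ^+ n <= 16 * t.
    case: n hn nmin => [|n] hn nmin; first by rewrite expr0; lra.
    have : ~~ (t <= 16 ^+ n) by apply/negP => /nmin; rewrite ltnn.
    by rewrite -ltNge exprS; lra.
  have gx : 0 <= gamma * (2 * 16 ^+ n) by rewrite !mulr_ge0 // ltW.
  have gy : 0 <= gamma * (8 * 16 ^+ n) by rewrite !mulr_ge0 // ltW.
  have /= h1 := hP n; have /= h2 := hQ n; have h3 := pos n.
  apply: (@rate_le _ _ _ (2 * 16 ^+ n) (8 * 16 ^+ n) _ g) => //; lra.
have := hfun_ge0 gamma; move: hM; case: (hfun gamma) => [h _ h0|//|//].
by exists h => //; rewrite lee_fin in h0.
Unshelve. all: by end_near. Qed.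

(** Here a n, a' n, b n, b' n are the sizes of I_n, N_n, J_n, M_n. A 1-Lipschitz
    g below (a n + a' n, a' n - a n) and above (b n + b' n, b n - b' n) makes
    Gamma_minus and Gamma_plus at tau n at most a n + a' n and b n + b' n: up
    to the error z n, the deficit a n - a' n / k is a multiple of gamma x - y at
    the point (x, y) = (a n + a' n, a' n - a n). The two bounds add up to at
    most (k + 1) n - 2 k delta n, since a n + b n is at most n. *)
Lemma hfun_le_deficits (R : realType) (k : nat) (a a' b b' : nat -> R)
    (delta z M : R) (n0 : nat)
    (tau := 2 * k%:R * delta / (k%:R + 1) - 2 * z) :
  (0 < k)%N -> (0 < n0)%N -> 0 <= z -> 0 < tau ->
  (forall n, (n0 <= n)%N -> [/\ 0 <= a n, 0 <= a' n, 0 <= b n & 0 <= b' n]) ->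
  (forall n, (n0 <= n)%N -> delta * n%:R <= a n - a' n / k%:R) ->
  (forall n, (n0 <= n)%N -> delta * n%:R <= b n - b' n / k%:R) ->
  (forall n, (n0 <= n)%N -> a n + b n <= n%:R) ->
  (forall n m, (n0 <= n)%N -> (n0 <= m)%N ->
     b m <= a' n + z * (n%:R + m%:R) \/ a n <= b' m + z * (n%:R + m%:R)) ->
  (k%:R + 1 - 2 * k%:R * delta) / tau < M ->
  (hfun ((k%:R - 1) / (k%:R + 1) : R) <= M%:E)%E.
Proof.
move=> k0 n00 z0 tau0 pos ha hb hab cross hM.
have k0R : 0 < k%:R :> R by rewrite ltr0n.
have [||||g [hg g0 hP hQ]] := @lipschitz_separation R
  (fun n => a (n0 + n)%N + a' (n0 + n)%N)
  (fun n => a' (n0 + n)%N - a (n0 + n)%N + 2 * z * (n0 + n)%:R)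
  (fun n => b (n0 + n)%N + b' (n0 + n)%N)
  (fun n => b (n0 + n)%N - b' (n0 + n)%N - 2 * z * (n0 + n)%:R).
- by move=> n; have [? ? ? ?] := pos _ (leq_addr n n0); apply: addr_ge0.
- move=> n; have [? ? ? ?] := pos _ (leq_addr n n0).
  have : 0 <= z * (n0 + n)%:R by rewrite mulr_ge0.
  lra.
- move=> n; have [? ? ? ?] := pos _ (leq_addr n n0).
  have : 0 <= z * (n0 + n)%:R by rewrite mulr_ge0.
  lra.
- move=> m n; have := cross _ _ (leq_addr n n0) (leq_addr m n0).
  have := ler_norm (a (n0 + n)%N + a' (n0 + n)%N - (b (n0 + m)%N + b' (n0 + m)%N)).
  have := ler_norm (b (n0 + m)%N + b' (n0 + m)%N - (a (n0 + n)%N + a' (n0 + n)%N)).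
  rewrite distrC => h1 h2 [h|h]; lra.
pose s := k%:R + 1 - 2 * k%:R * delta.
have sum_le n : (n0 <= n)%N -> a n + a' n + (b n + b' n) <= s * n%:R.
  have mulk (u u' : R) : delta * n%:R <= u - u' / k%:R ->
      k%:R * (delta * n%:R) <= k%:R * u - u'.
    rewrite -(ler_pM2l k0R) => /le_trans; apply.
    by rewrite mulrBr [k%:R * (u' / _)]mulrC divfK ?gt_eqF.
  move=> hn; have h1 := mulk _ _ (ha n hn); have h2 := mulk _ _ (hb n hn).
  have h3 : (k%:R + 1) * (a n + b n) <= (k%:R + 1) * n%:R.
    by rewrite ler_wpM2l ?hab //; lra.
  rewrite /s; move: h3; rewrite mulrDl mulrDr; lra.
have s0 : 0 <= s.
  rewrite -(@pmulr_lge0 _ n0%:R) ?ltr0n // -[in leRHS]mulr_natr.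
  have [? ? ? ?] := pos n0 (leqnn _); have := sum_le n0 (leqnn _); lra.
apply: (hfun_le hg g0); near=> t.
have t0 : 0 < t by near: t; exact: nbhs_pinfty_gt.
have tn0 : tau * n0%:R < t by near: t; apply: nbhs_pinfty_gt; exact: num_real.
have ts : s / (M - s / tau) < t by near: t; apply: nbhs_pinfty_gt; exact: num_real.
pose n := (Num.truncn (t / tau)).+1.
have tn : t <= tau * n%:R.
  by rewrite mulrC -ler_pdivrMr // ltW // truncnS_gt.
have nt : tau * n%:R <= t + tau.
  rewrite /n -natr1 mulrDr mulr1 lerD2r mulrC -ler_pdivlMr //.
  by rewrite truncn_le divr_ge0 // ltW.
have n0n : (n0 <= n)%N.
  by rewrite -(ler_nat R) -(ler_pM2l tau0); lra.
have [q nE] : exists q, n = (n0 + q)%N by exists (n - n0)%N; rewrite subnKC.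
have {hP} /= := hP q; have {hQ} /= := hQ q; rewrite -nE => hQ hP.
have [? ? ? ?] := pos n n0n.
have key (u u' : R) : delta * n%:R <= u - u' / k%:R ->
    t <= (k%:R - 1) / (k%:R + 1) * (u + u') - (u' - u + 2 * z * n%:R).
  move=> h; apply: le_trans tn _.
  have -> : (k%:R - 1) / (k%:R + 1) * (u + u') - (u' - u + 2 * z * n%:R)
    = 2 * k%:R / (k%:R + 1) * (u - u' / k%:R) - 2 * z * n%:R.
    by field; rewrite !gt_eqF //; lra.
  have c0 : 0 <= 2 * k%:R / (k%:R + 1) :> R by rewrite divr_ge0 ?mulr_ge0 //; lra.
  have := ler_wpM2l c0 h.
  have -> : tau * n%:R = 2 * k%:R / (k%:R + 1) * (delta * n%:R) - 2 * z * n%:R.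
    by rewrite /tau; ring.
  lra.
apply: (@rate_le _ _ _ (a n + a' n) (b n + b' n)) => //.
- exact: addr_ge0.
- by have := key _ _ (ha n n0n); lra.
- exact: addr_ge0.
- by have := key _ _ (hb n n0n); lra.
apply: le_trans (sum_le n n0n) _.
have hd : 0 < M - s / tau by rewrite subr_gt0.
move: ts; rewrite ltr_pdivrMr // => ts.
have : s * n%:R <= s / tau * (t + tau).
  rewrite -mulrA ler_wpM2l // [_^-1 * _]mulrC ler_pdivlMr //; lra.
rewrite mulrDr divfK ?gt_eqF //; lra.
Unshelve. all: by end_near. Qed.

(** * Upper density and copies of the tree *)

Definition count_upto (S : set nat) n : nat := count (fun m => `[< S m >]) (iota 1 n).

Lemma card_upto (S : set nat) n :
  #|` fset_set (S `&` [set m | (1 <= m <= n)%N]) | = count_upto S n.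
Proof.
have fin : finite_set (S `&` [set m | (1 <= m <= n)%N]).
  apply: (@sub_finite_set _ _ [set` iota 1 n]); last exact: finite_seq.
  by move=> m [_ /= hm]; rewrite mem_iota; lia.
have -> : fset_set (S `&` [set m | (1 <= m <= n)%N])
    = [fset m in [seq m <- iota 1 n | `[< S m >]]]%fset.
  apply/fsetP => m; rewrite in_fset_set // inE mem_filter mem_iota add1n ltnS.
  apply/idP/idP; rewrite inE /=.
    by move=> [Sm ->]; rewrite andbT; apply/asboolP.
  by move=> /andP[/asboolP Sm ?].
by rewrite card_fseq undup_id ?filter_uniq ?iota_uniq // size_filter.
Qed.

Section UpperDensity.
Variable R : realType.

Let u (S : set nat) (n : nat) : R := (count_upto S n)%:R / n%:R.

Lemma upper_densityE S : upper_density R S = inf (range (sups (u S))).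
Proof.
have -> : upper_density R S = limn_sup (u S).
  by congr limn_sup; apply/funext => n; rewrite /u -card_upto.
apply: limn_supE; exists 1; split => // M M1 n _ /=.
rewrite ger0_norm; last by rewrite divr_ge0.
apply: le_trans (ltW M1); case: n => [|n]; first by rewrite /u invr0 mulr0.
rewrite ler_pdivrMr ?ltr0n // mul1r ler_nat -[leqRHS](size_iota 1).
exact: count_size.
Qed.

Lemma count_ratio_ge0 S n : 0 <= u S n.
Proof. by rewrite divr_ge0. Qed.

Lemma count_ratio_le1 S n : u S n <= 1.
Proof.
case: n => [|n]; first by rewrite /u invr0 mulr0.
rewrite ler_pdivrMr ?ltr0n // mul1r ler_nat -[leqRHS](size_iota 1).
exact: count_size.
Qed.

Lemma has_sup_sdrop S n : has_sup (sdrop (u S) n).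
Proof.
split; first by exists (u S n); exists n => /=.
by exists 1 => _ [m _ <-]; exact: count_ratio_le1.
Qed.

Lemma upper_density_ge S (lam : R) :
  (forall j, exists n, (j < n)%N /\ lam * n%:R <= (count_upto S n)%:R) ->
  lam <= upper_density R S.
Proof.
move=> h; rewrite upper_densityE; apply: lb_le_inf; first by exists (sups (u S) 0); exists 0.
move=> _ [j _ <-]; have [n [jn hn]] := h j.
apply: (@le_trans _ _ (u S n)).
  by rewrite ler_pdivlMr // ltr0n (leq_ltn_trans _ jn).
by apply: ub_le_sup; [case: (has_sup_sdrop S j)|exists n => //=; exact: ltnW].
Qed.

Lemma upper_density_le S (M : R) j :
  (forall n, (j < n)%N -> (count_upto S n)%:R <= M * n%:R) ->
  upper_density R S <= M.
Proof.
move=> h; rewrite upper_densityE.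
apply: (@le_trans _ _ (sups (u S) j.+1)).
  apply: ge_inf; last by exists j.+1.
  exists 0 => _ [m _ <-]; apply: (@le_trans _ _ (u S m)); first exact: count_ratio_ge0.
  by apply: ub_le_sup; [case: (has_sup_sdrop S m)|exists m => /=].
apply: ge_sup; first by case: (has_sup_sdrop S j.+1).
move=> _ [n /= jn <-]; rewrite ler_pdivrMr ?h // ltr0n.
exact: leq_ltn_trans jn.
Qed.

End UpperDensity.

Lemma tree_copy (k : nat) (c : nat -> nat -> bool) (chi : bool) (phi : seq 'I_k -> nat) :
  symmetric c -> injective phi -> (forall p, (0 < phi p)%N) ->
  (forall p i, c (phi p) (phi (rcons p i)) = chi) ->
  exists H' : graph nat, [/\ subgraph H' KN, monochromatic c H',
    isomorphic (kary_tree k) H' & vset H' = range phi].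
Proof.
move=> c_sym inj pos col.
pose ad x y := exists p q, [/\ tree_adj p q, x = phi p & y = phi q].
have ad_vset x y : ad x y -> range phi x /\ range phi y.
  by move=> [p [q [_ -> ->]]]; split; [exists p|exists q].
have ad_sym x y : ad x y -> ad y x.
  by move=> [p [q [h -> ->]]]; exists q, p; split=> //; exact: tree_adj_sym.
have ad_irr x : ~ ad x x.
  by move=> [p [q [h -> /inj E]]]; move: h; rewrite E; exact: tree_adj_irr.
exists (Graph ad_vset ad_sym ad_irr); split=> //.
- split=> [_ [p _ <-]|x y [p [q [h -> ->]]]]; first exact: pos.
  split; [exact: pos|exact: pos|move=> /inj E].
  by move: h; rewrite E; exact: tree_adj_irr.
- exists chi => x y [p [q [[[i ->]|[i ->]] -> ->]]]; first exact: col.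
  by rewrite c_sym col.
- exists phi; first split.
  + by move=> p _; exists p.
  + by move=> p q _ _; exact: inj.
  + by move=> _ [p _ <-]; exists p.
  + move=> p q _ _; split=> [h|[p' [q' [h /inj -> /inj ->]]] //].
    by exists p, q.
Qed.

(** The colour of v is the one that v has to almost all vertices, in the sense
    of a nonprincipal ultrafilter. *)
Lemma vertex_colouring (c : nat -> nat -> bool) :
  exists col : nat -> bool, forall (chi : bool) (s : seq nat) m,
    all (fun v => col v == chi) s ->
    exists2 w, (m < w)%N & all (fun v => c v w == chi) s.
Proof.
have [U [UU sU]] := ultraFilterLemma (@eventually_filter).
pose col v := `[< U [set w | c v w = true] >].
have colP v : U [set w | c v w = col v].
  rewrite /col; case: asboolP => // h.
  have [//|] := in_ultra_setVsetC [set w | c v w = true] UU.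
  by apply: filterS => w /=; case: (c v w).
exists col => chi s m hs.
(* Sets of the ultrafilter are closed under finite intersections, and contain
   all final segments. *)
have hU : U [set w | (m < w)%N /\ all (fun v => c v w == chi) s].
  elim: s hs => [|v s IH] /=.
    move=> _; apply: sU; exists m.+1 => // w /= hw; by split.
  move=> /andP[/eqP vchi /IH h]; apply: filterS (filterI (colP v) h) => w /= [E [mw aw]].
  by rewrite E vchi eqxx.
have [w [mw aw]] := filter_ex hU; by exists w.
Qed.

(** * Dense monochromatic trees *)

Lemma size_filter_hit (T : eqType) (A : seq T) (V : seq nat) (F : T -> nat) (p : pred T) :
  uniq A -> {in A &, injective F} -> (forall x, x \in A -> p x -> F x \in V) ->
  (size [seq x <- A | p x] <= size V)%N.
Proof.
move=> uA injF hF; rewrite -(size_map F); apply: uniq_leq_size.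
  rewrite map_inj_in_uniq ?filter_uniq // => x y.
  by rewrite !mem_filter => /andP[_ xA] /andP[_ yA]; exact: injF.
by move=> z /mapP[x]; rewrite mem_filter => /andP[px xA] ->; exact: hF.
Qed.

(** Each vertex of V meets at most three of the stars: as the centre, as the
    parent and as a child. *)
Lemma forest_avoiding (k n : nat) (e : rel nat) (K : pred nat) (V A : seq nat)
    (C : nat -> 'I_k -> nat) (P lx ly : nat -> nat) :
  (0 < k)%N -> nat_forest e K n A C P lx ly ->
  exists2 A', (size A <= size A' + 3 * size V)%N &
    [/\ uniq A', {subset A' <= A}, forall x, x \in A' -> x \notin V,
        forall x, x \in A' -> P x \notin V & forall x j, x \in A' -> C x j \notin V].
Proof.
move=> k0 F; have i0 : 'I_k by exact: Ordinal k0.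
pose bad x := [|| x \in V, P x \in V | [exists j, C x j \in V]].
exists [seq x <- A | ~~ bad x]; last first.
  split; first by rewrite filter_uniq // (nf_uniq F).
  - by move=> x; rewrite mem_filter => /andP[].
  - by move=> x; rewrite mem_filter !negb_or => /andP[/and3P[]].
  - by move=> x; rewrite mem_filter !negb_or => /andP[/and3P[]].
  - by move=> x j; rewrite mem_filter !negb_or => /andP[/and3P[_ _ /existsPn]].
suff hbad : (count bad A <= 3 * size V)%N.
  by rewrite -[X in (X <= _)%N](count_predC bad) size_filter addnC leq_add2l.
have h1 : (size [seq x <- A | x \in V] <= size V)%N.
  by apply: (size_filter_hit (F := id)) (nf_uniq F) _ _ => // x y.
have h2 : (size [seq x <- A | P x \in V] <= size V)%N.
  apply: (size_filter_hit (F := P)) (nf_uniq F) _ _ => // x y xA yA.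
  exact: (nf_par_inj F).
have h3 : (size [seq x <- A | [exists j, C x j \in V]] <= size V)%N.
  pose G x := C x (odflt i0 [pick j | C x j \in V]).
  apply: (size_filter_hit (F := G)) (nf_uniq F) _ _.
    by move=> x y xA yA /(nf_child_inj F xA yA)[].
  move=> x _ /existsP[j hj]; rewrite /G; case: pickP => //= h.
  by have := h j; rewrite hj.
apply: (@leq_trans (size [seq x <- A | x \in V] + size [seq x <- A | P x \in V]
   + size [seq x <- A | [exists j, C x j \in V]])); last by lia.
rewrite !size_filter; apply: leq_trans (_ : (count [pred x | x \in V] A
   + count [pred x | (P x \in V) || [exists j, C x j \in V]] A <= _)%N).
  rewrite -count_predUI; apply: leq_trans (leq_addr _ _); apply: sub_count => x.
  by rewrite /= /bad.
rewrite -addnA leq_add2l -count_predUI; apply: leq_trans (leq_addr _ _).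
by apply: sub_count => x.
Qed.

(** At a scale n that is large compared with the vertices used so far, the part
    of the forest that avoids them is inserted, and then all the vertices of K
    up to n are absorbed. *)
Lemma dense_tree (R : realType) (k : nat) (c : nat -> nat -> bool) (chi : bool)
    (col : nat -> bool) (lam eps : R) (K := fun v => (0 < v)%N && (col v == chi))
    (e := fun x y => c x y == chi) :
  (0 < k)%N -> symmetric c -> 0 < eps ->
  (forall (s : seq nat) m, all (fun v => col v == chi) s ->
    exists2 w, (m < w)%N & all (fun v => c v w == chi) s) ->
  (forall m, exists2 v, (m < v)%N & K v) ->
  (forall m, exists2 n, (m <= n)%N & exists A C P lx ly,
     @nat_forest k e K n A C P lx ly /\
     (count (predC K) (iota 1 n))%:R - (1 - lam) * n%:R <= (size A)%:R) ->
  exists H' : graph nat, [/\ subgraph H' KN, monochromatic c H',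
    isomorphic (kary_tree k) H' & lam - eps <= upper_density R (vset H')].
Proof.
move=> k0 c_sym eps0 joined Kinf dens.
have e_sym : symmetric e by move=> x y; rewrite /e c_sym.
have Kpos v : K v -> (0 < v)%N by case/andP.
have Kjoin (s : seq nat) m : all K s -> exists2 w, (m < w)%N & all (e w) s.
  move=> /allP hs; have [|w mw /allP hw] := joined s m.
    by apply/allP => v /hs /andP[].
  by exists w => //; apply/allP => v /hw; rewrite /e c_sym.
pose Q (j : nat) (V : seq nat) := exists n, (j < n)%N /\
  (lam - eps) * n%:R <= (count (mem V) (iota 1 n))%:R.
have [] := @tree_of_stages k e K k0 e_sym Kpos Kinf Kjoin Q.
  move=> V ch r0 j fs.
  pose m := maxn j.+1 (Num.truncn ((3 * size V)%:R / eps)).+1.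
  have [n mn [A [C [P [lx [ly [F hA]]]]]]] := dens m.
  have [A' sA [uA' subA A'V PV CV]] := forest_avoiding V k0 F.
  have dom x : x \in A' -> (0 < x <= n)%N && ~~ K x by move=> /subA/(nf_dom F).
  have [|||||||V1 [ch1 [fs1 s1 x1 A1]]] := @insert_forest k e K k0 e_sym Kpos Kinf Kjoin
      V ch r0 A' C P lx ly fs.
  - by move=> x xA; have /andP[/andP[? _] ?] := dom x xA; split=> //; exact: A'V.
  - move=> x xA; have /andP[KP eP] := nf_par F (subA x xA).
    by split=> //; [exact: PV|rewrite e_sym].
  - move=> x i xA; have /andP[KC eC] := nf_child F i (subA x xA).
    by split=> //; exact: CV.
  - by move=> x x' i i' /subA xA /subA x'A; exact: (nf_child_inj F xA x'A).
  - by move=> x x' /subA xA /subA x'A; exact: (nf_par_inj F xA x'A).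
  - by move=> x /subA; exact: (nf_par_layer F).
  - by move=> x i /subA; exact: (nf_child_layer F).
  have Ks : all K [seq v <- iota 1 n | K v] by rewrite filter_all.
  have [V2 [ch2 [fs2 s2 x2 K2]]] := absorb k0 e_sym Kpos Kinf Kjoin fs1 Ks.
  exists V2, ch2; split=> //; [by move=> v /s1/s2|by move=> v i w /x1/x2|].
  exists n; split; first by apply: leq_trans mn; rewrite leq_maxl.
  have cA : (size A' <= count (mem A') (iota 1 n))%N.
    rewrite -size_filter; apply: uniq_leq_size uA' _ => x xA.
    by rewrite mem_filter /= xA mem_iota; have := dom x xA; lia.
  have cV : (count K (iota 1 n) + count (mem A') (iota 1 n)
     <= count (mem V2) (iota 1 n))%N.
    rewrite -count_predUI [X in (_ + X)%N](eq_count (a2 := pred0)) ?count_pred0 ?addn0.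
      rewrite -!size_filter; apply: uniq_leq_size.
        by rewrite filter_uniq ?iota_uniq.
      move=> x; rewrite !mem_filter => /andP[/= h xn]; rewrite xn andbT.
      case/orP: h => [Kx|/A1/s2 //]; apply: K2; by rewrite mem_filter Kx.
    by move=> x /=; apply/negbTE/negP => /andP[Kx /dom]; rewrite Kx andbF.
  have cK : (count K (iota 1 n) + count (predC K) (iota 1 n) = n)%N.
    by rewrite count_predC size_iota.
  have n3 : (3 * size V)%:R <= eps * n%:R :> R.
    rewrite mulrC -ler_pdivrMr //; apply: ltW; apply: lt_le_trans (truncnS_gt _) _.
    by rewrite ler_nat (leq_trans _ mn) // leq_maxr.
  have h1 : (size A)%:R <= (size A')%:R + (3 * size V)%:R :> R by rewrite -natrD ler_nat.
  have h2 : (count K (iota 1 n))%:R + (size A')%:R <= (count (mem V2) (iota 1 n))%:R :> R.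
    by rewrite -natrD ler_nat; lia.
  have h3 : (count K (iota 1 n))%:R + (count (predC K) (iota 1 n))%:R = n%:R :> R.
    by rewrite -natrD cK.
  by move: hA; rewrite mulrBl mul1r mulrBl; lra.
move=> phi [inj pos edge rng].
have [|H' [h1 h2 h3 h4]] := tree_copy c_sym inj pos (chi := chi).
  by move=> p i; apply/eqP/edge.
exists H'; split=> //; rewrite h4; apply: upper_density_ge => j.
have [V [[n [jn hn]] hV]] := rng j; exists n; split=> //.
apply: le_trans hn _; rewrite ler_nat; apply: sub_count => v /= vV.
by have [p hp] := hV v vV; apply/asboolP; exists p.
Qed.

(** * The lower bound *)

Lemma leq_sum_uniq_sub (s t : seq nat) (P : pred nat) (F : nat -> nat) :
  uniq s -> uniq t -> (forall y, y \in s -> (y \in t) && P y) ->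
  (\sum_(y <- s) F y <= \sum_(y <- t | P y) F y)%N.
Proof.
move=> us ut st; rewrite -[X in (_ <= X)%N]big_filter.
apply: (uniq_sub_le_big leqnn (fun m n => leq_addr n m)) => //.
  by rewrite filter_uniq.
by move=> y /st; rewrite mem_filter andbC.
Qed.

(** Each pair in the product has one of the two colours, and is counted by the
    sum of that colour. *)
Lemma cross_pairs (c : nat -> nat -> bool) (I N J M : seq nat) (KI KJ : pred nat) (p q : nat) :
  symmetric c -> uniq I -> uniq J ->
  (forall x, x \in I -> KI x && (x < q)%N) -> (forall y, y \in J -> KJ y && (y < p)%N) ->
  (size [seq x <- I | x \notin M] * size [seq y <- J | y \notin N]
   <= \sum_(x <- I) \sum_(0 <= y < p | KJ y && (y \notin N)) (c x y == true)
    + \sum_(y <- J) \sum_(0 <= x < q | KI x && (x \notin M)) (c y x == false))%N.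
Proof.
move=> c_sym uI uJ hI hJ.
set s := [seq x <- I | x \notin M]; set t := [seq y <- J | y \notin N].
have -> : (size s * size t = \sum_(x <- s) \sum_(y <- t) (c x y == true)
    + \sum_(y <- t) \sum_(x <- s) (c y x == false))%N.
  rewrite [X in (_ + X)%N]exchange_big -big_split /= -sum1_size big_distrl /=.
  apply: eq_bigr => x _; rewrite -big_split mul1n -sum1_size; apply: eq_bigr => y _.
  by rewrite [c y x]c_sym; case: (c x y).
have sub_sum (r : seq nat) (Q : pred nat) (F : nat -> nat) :
    (\sum_(x <- [seq x <- r | Q x]) F x <= \sum_(x <- r) F x)%N.
  by rewrite big_filter [X in (_ <= X)%N](bigID Q) /= leq_addr.
apply: leq_add; apply: leq_trans (sub_sum _ _ _); apply: leq_sum => x _.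
  apply: leq_sum_uniq_sub; rewrite ?filter_uniq ?iota_uniq // => y.
  rewrite mem_filter => /andP[yN /hJ/andP[-> yp]].
  by rewrite yN mem_index_iota yp.
apply: leq_sum_uniq_sub; rewrite ?filter_uniq ?iota_uniq // => y.
rewrite mem_filter => /andP[yN /hI/andP[-> yp]].
by rewrite yN mem_index_iota yp.
Qed.

Lemma size_filter_notin (I M : seq nat) : uniq I ->
  (size I <= size [seq x <- I | x \notin M] + size M)%N.
Proof.
move=> uI; rewrite -[X in (X <= _)%N](count_predC (mem M)) size_filter addnC leq_add2l.
rewrite -size_filter; apply: uniq_leq_size; first by rewrite filter_uniq.
by move=> x; rewrite mem_filter => /andP[].
Qed.

Lemma uniq_size_le (s : seq nat) n : uniq s ->
  (forall x, x \in s -> (0 < x <= n)%N) -> (size s <= n)%N.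
Proof.
move=> us hs; rewrite -[leqRHS](size_iota 1); apply: uniq_leq_size => // x /hs.
by rewrite mem_iota add1n ltnS.
Qed.

Section LowerBound.
Variables (R : realType) (k : nat) (h : R).
Hypothesis k_gt0 : (0 < k)%N.
Hypothesis hE : hfun ((k%:R - 1) / (k%:R + 1) : R) = h%:E.

Let f : R := 1 - 1 / (2 * k%:R / (1 + k%:R) ^+ 2 * h + 2 * k%:R / (1 + k%:R)).

(** The number d0 is the claimed proportion of gaps. If no copy is dense enough,
    then each colour has obstructions with some delta > d0 at all large scales,
    and [hfun_le_deficits] gives hfun < h. *)
Lemma tree_density_lower (c : nat -> nat -> bool) (mu : R) :
  symmetric c -> mu < f ->
  exists H' : graph nat, [/\ subgraph H' KN, monochromatic c H',
    isomorphic (kary_tree k) H' & mu <= upper_density R (vset H')].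
Proof.
move=> c_sym muf; apply: contrapT => noH.
have k0R : 0 < k%:R :> R by rewrite ltr0n.
have k1 : 0 < k%:R + 1 :> R by lra.
have h0 : 0 <= h by rewrite -lee_fin -hE hfun_ge0.
pose g0 := f - mu; have g00 : 0 < g0 by rewrite subr_gt0.
pose d0 := 1 - f.
have den0 : 0 < 2 * k%:R / (1 + k%:R) ^+ 2 * h + 2 * k%:R / (1 + k%:R) :> R.
  apply: ltr_wpDl; first by rewrite mulr_ge0 // divr_ge0 ?mulr_ge0 ?exprn_ge0 //; lra.
  by rewrite divr_gt0 ?mulr_gt0 //; lra.
have d0den : d0 = 1 / (2 * k%:R / (1 + k%:R) ^+ 2 * h + 2 * k%:R / (1 + k%:R)).
  by rewrite /d0 /f opprB addrC subrK.
have d0E : k%:R + 1 - 2 * k%:R * d0 = h * (2 * k%:R * d0 / (k%:R + 1)).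
  rewrite d0den; move: den0; set den := (_ + _) => den0.
  have -> : 2 * k%:R * (1 / den) = 2 * k%:R / den by rewrite div1r.
  have dn : den != 0 by rewrite gt_eqF.
  apply: (mulfI dn).
  have -> : den * (k%:R + 1 - 2 * k%:R / den) = den * (k%:R + 1) - 2 * k%:R.
    by field; rewrite gt_eqF.
  have -> : den * (h * (2 * k%:R / den / (k%:R + 1))) = h * (2 * k%:R) / (k%:R + 1).
    by field; rewrite !gt_eqF.
  by rewrite /den; field; rewrite !gt_eqF // addrC.
have d00 : 0 < d0 by rewrite d0den divr_gt0.
pose eps1 := g0 / 4; have eps10 : 0 < eps1 by rewrite divr_gt0.
pose delta := d0 + g0 / 4.
have delta0 : 0 < delta by rewrite addr_gt0.
(* The error z is small against the gap between delta and d0. *)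
pose z := Num.min (k%:R * eps1 / (2 * (h + 1))) (k%:R * delta / (2 * (k%:R + 1))).
have z0 : 0 < z.
  by rewrite lt_min !divr_gt0 ?mulr_gt0 //; lra.
have zh : 2 * h * z <= k%:R * eps1.
  have : z <= k%:R * eps1 / (2 * (h + 1)) by rewrite ge_min lexx.
  by rewrite ler_pdivlMr; [lra|rewrite mulr_gt0 //; lra].
have zd : 2 * z <= k%:R * delta / (k%:R + 1).
  have : z <= k%:R * delta / (2 * (k%:R + 1)) by rewrite ge_min lexx orbT.
  rewrite ler_pdivlMr ?mulr_gt0 // => ?; rewrite ler_pdivlMr //; lra.
pose tau := 2 * k%:R * delta / (k%:R + 1) - 2 * z.
have kd : 0 < k%:R * delta / (k%:R + 1) by rewrite divr_gt0 // mulr_gt0.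
have tau0 : 0 < tau.
  by rewrite /tau -!mulrA mulrA -mulrA; lra.
have gap : (k%:R + 1 - 2 * k%:R * delta) / tau < h.
  rewrite ltr_pdivrMr //.
  have E1 : k%:R + 1 - 2 * k%:R * delta = k%:R + 1 - 2 * k%:R * d0 - 2 * k%:R * eps1.
    by rewrite /delta /eps1; ring.
  have E2 : h * tau = h * (2 * k%:R * d0 / (k%:R + 1))
      + h * (2 * k%:R * eps1 / (k%:R + 1)) - 2 * h * z.
    by rewrite /tau /delta -/eps1; field; rewrite gt_eqF.
  have : 0 <= h * (2 * k%:R * eps1 / (k%:R + 1)).
    by rewrite mulr_ge0 // divr_ge0 ?mulr_ge0 // ltW.
  have : 0 < k%:R * eps1 by rewrite mulr_gt0.
  by rewrite E1 E2 d0E; lra.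
pose q := (Num.truncn z^-1).+1.
have qz : 1 <= z * q%:R by rewrite mulrC -ler_pdivrMr // div1r ltW // truncnS_gt.
have zz0 : 0 < z ^+ 2 by rewrite exprn_gt0.
have [n0 hn0] := forest_or_obstruction k_gt0 (ltn0Sn _ : (0 < q)%N) eps10 zz0.
have [col hcol] := vertex_colouring c.
pose K (chi : bool) v := (0 < v)%N && (col v == chi).
pose e (chi : bool) x y := c x y == chi.
pose obst (chi : bool) n (IN : seq nat * seq nat) := [/\ uniq IN.1 && uniq IN.2,
     forall x, x \in IN.1 -> (0 < x <= n)%N && ~~ K chi x, forall y, y \in IN.2 -> K chi y,
     delta * n%:R <= (size IN.1)%:R - (size IN.2)%:R / k%:R &
     (\sum_(x <- IN.1) \sum_(0 <= y < (q * n).+1 | K chi y && (y \notin IN.2)) e chi x y)%:R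
       <= z ^+ 2 * n%:R ^+ 2].
have obstructed chi : (forall m, exists2 v, (m < v)%N & K chi v) ->
    exists m, forall n, (m <= n)%N -> exists IN, obst chi n IN.
  move=> Kinf; apply: contrapT => hno; apply: noH.
  have -> : mu = (f - g0 / 2) - g0 / 2 by rewrite /g0; lra.
  apply: (@dense_tree R k c chi col _ (g0 / 2) k_gt0 c_sym) => //.
  - by rewrite divr_gt0.
  - by move=> s m; exact: hcol.
  - move=> m; apply: contrapT => hm; apply: hno; exists (maxn m n0) => n.
    rewrite geq_max => /andP[mn n0n].
    have [[A [C [P [lx [ly [F hA]]]]]]|[I [N ?]]] :=
      hn0 (e chi) (K chi) n delta n0n (ltW delta0); last by exists (I, N).
    case: hm; exists n => //; exists A, C, P, lx, ly; split=> //.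
    have E : 1 - (f - g0 / 2) = delta + eps1 by rewrite /delta /d0 /eps1; lra.
    by rewrite E.
have neq_bool (a b : bool) : (a != b) = (a == ~~ b) by case: a b => [] [].
have notK chi v : (0 < v)%N -> ~~ K chi v = K (~~ chi) v.
  by move=> v0; rewrite /K v0 neq_bool.
have Kinf chi : forall m, exists2 v, (m < v)%N & K chi v.
  move=> B; apply: contrapT => hB.
  have small v : K chi v -> (v <= B)%N.
    by move=> Kv; rewrite leqNgt; apply/negP => Bv; apply: hB; exists v.
  have [|m hm] := obstructed (~~ chi).
    move=> m; exists (maxn m B).+1; first by rewrite ltnS leq_maxl.
    rewrite -notK //; apply/negP => /small.
    by rewrite leqNgt ltnS leq_maxr.
  pose n := maxn m (Num.truncn (B%:R / delta)).+1.
  have [[I N] [/= /andP[uI _] hI _ hd _]] := hm n (leq_maxl _ _).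
  have IB : (size I <= B)%N.
    apply: uniq_size_le uI _ => x /hI/andP[/andP[x0 xn] Kx]; rewrite x0 /= small //.
    by move: Kx; rewrite notK // negbK.
  have N0 : 0 <= (size N)%:R / k%:R :> R by rewrite divr_ge0.
  have IBR : (size I)%:R <= B%:R :> R by rewrite ler_nat.
  have : B%:R < delta * n%:R.
    rewrite mulrC -ltr_pdivrMr //; apply: lt_le_trans (truncnS_gt _) _.
    by rewrite ler_nat leq_maxr.
  lra.
have [m1 hm1] := obstructed true (Kinf true).
have [m2 hm2] := obstructed false (Kinf false).
have /choice[IN hIN] : forall n, exists IN, (m1 <= n)%N -> obst true n IN.
  move=> n; case: (leqP m1 n) => [/hm1[IN ?]|_]; last by exists ([::], [::]).
  by exists IN.
have /choice[JM hJM] : forall n, exists s, (m2 <= n)%N -> obst false n s.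
  move=> n; case: (leqP m2 n) => [/hm2[s ?]|_]; last by exists ([::], [::]).
  by exists s.
pose n1 := maxn 1 (maxn m1 m2).
have n1P n : (n1 <= n)%N -> obst true n (IN n) /\ obst false n (JM n).
  by rewrite !geq_max => /and3P[_ ? ?]; split; [exact: hIN|exact: hJM].
pose M := ((k%:R + 1 - 2 * k%:R * delta) / tau + h) / 2.
have : (hfun ((k%:R - 1) / (k%:R + 1) : R) <= M%:E)%E.
  apply: (@hfun_le_deficits R k (fun n => (size (IN n).1)%:R) (fun n => (size (IN n).2)%:R)
    (fun n => (size (JM n).1)%:R) (fun n => (size (JM n).2)%:R) delta z M n1) => //.
  - by rewrite leq_maxl.
  - exact: ltW.
  - by move=> n /n1P[[_ _ _ hd _] _].
  - by move=> n /n1P[_ [_ _ _ hd _]].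
  - move=> n /n1P[[/andP[uI _] hI _ _ _] [/andP[uJ _] hJ _ _ _]].
    rewrite -natrD ler_nat -size_cat; apply: uniq_size_le.
      rewrite cat_uniq uI uJ andbT /=; apply/hasPn => x /hJ/andP[/andP[x0 _] KJ].
      by apply/negP => /hI/andP[_]; rewrite notK // (negbTE KJ).
    by move=> x; rewrite mem_cat => /orP[/hI|/hJ] /andP[].
  - move=> n m hn hm; have [[/andP[uI _] hI hN _ tI] _] := n1P n hn.
    have [_ [/andP[uJ _] hJ hM _ tJ]] := n1P m hm.
    have n0R : 0 <= n%:R :> R by []. have m0R : 0 <= m%:R :> R by [].
    have zn0 : 0 <= z * n%:R by rewrite mulr_ge0 // ltW.
    have zm0 : 0 <= z * m%:R by rewrite mulr_ge0 // ltW.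
    have sI : (size (IN n).1)%:R <= n%:R :> R.
      by rewrite ler_nat; apply: uniq_size_le uI _ => x /hI/andP[].
    have sJ : (size (JM m).1)%:R <= m%:R :> R.
      by rewrite ler_nat; apply: uniq_size_le uJ _ => x /hJ/andP[].
    (* Scales that differ by more than the factor q >= 1/z satisfy the claim because
   the smaller one is within the error. *)
    have far (i j : nat) : (q * i < j)%N -> i%:R <= z * j%:R.
      rewrite -(ltr_nat R) natrM => hij.
      have hi : 1 * i%:R <= z * q%:R * i%:R by rewrite ler_wpM2r.
      have : z * (q%:R * i%:R) <= z * j%:R by rewrite ler_wpM2l ?ltW.
      by rewrite mul1r in hi; lra.
    have [nm|mn] := leqP m (q * n); last first.
      by right; have := far _ _ mn; have : 0 <= (size (JM m).2)%:R :> R by []; lra.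
    have [mn|nm'] := leqP n (q * m); last first.
      by left; have := far _ _ nm'; have : 0 <= (size (IN n).2)%:R :> R by []; lra.
    apply: contrapT => /not_orP[/negP hJN /negP hIM].
    rewrite -ltNge in hJN; rewrite -ltNge in hIM.
    have := @cross_pairs c (IN n).1 (IN n).2 (JM m).1 (JM m).2 (K false) (K true)
      (q * n).+1 (q * m).+1 c_sym uI uJ.
    set t1 := (\sum_(x <- _) _)%N in tI; set t2 := (\sum_(x <- _) _)%N in tJ.
    have hx x : x \in (IN n).1 -> K false x && (x < (q * m).+1)%N.
      move=> /hI/andP[/andP[x0 xn]]; rewrite notK // => ->.
      by rewrite ltnS (leq_trans xn).
    have hy y : y \in (JM m).1 -> K true y && (y < (q * n).+1)%N.
      move=> /hJ/andP[/andP[x0 xn]]; rewrite notK // => ->.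
      by rewrite ltnS (leq_trans xn).
    move=> /(_ hx hy); rewrite -/t1 -/t2.
    have := size_filter_notin (JM m).2 uI; have := size_filter_notin (IN n).2 uJ.
    set u := size [seq x <- _ | _]; set w := size [seq x <- _ | _] => hu hw huw.
    have {}hu : (size (JM m).1)%:R <= u%:R + (size (IN n).2)%:R :> R by rewrite -natrD ler_nat.
    have {}hw : (size (IN n).1)%:R <= w%:R + (size (JM m).2)%:R :> R by rewrite -natrD ler_nat.
    have {}huw : w%:R * u%:R <= t1%:R + t2%:R :> R by rewrite -natrM -natrD ler_nat.
    have zz : 0 <= z * (n%:R + m%:R) by rewrite mulrDr addr_ge0.
    have : (z * (n%:R + m%:R)) * (z * (n%:R + m%:R)) < w%:R * u%:R.
      by apply: ltr_pM => //; lra.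
    have : z ^+ 2 * n%:R ^+ 2 + z ^+ 2 * m%:R ^+ 2
         <= (z * (n%:R + m%:R)) * (z * (n%:R + m%:R)).
      have : 0 <= (z * n%:R) * (z * m%:R) by rewrite mulr_ge0.
      rewrite !expr2; lra.
    lra.
  - by rewrite -/tau /M; lra.
by rewrite hE lee_fin /M; lra.
Qed.
End LowerBound.

(** * The upper bound *)

(** The naturals can be split into two classes with prescribed sizes on a
    sequence of initial segments, as long as these do not decrease and
    their sum is unbounded. *)
Lemma interleaving (bl rd : nat -> nat) :
  {homo bl : m n / (m <= n)%N} -> {homo rd : m n / (m <= n)%N} ->
  (forall v, exists s, (v < bl s + rd s)%N) ->
  exists blue : pred nat, forall s, count blue (iota 1 (bl s + rd s)) = bl s.
Proof.
move=> mb mr unb.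
(* Vertex v.+1 belongs to the first stage whose segment is longer than v; it is
   blue as long as the stage has not received all its blue vertices. *)
pose sg v := ex_minn (unb v).
have sgP v : (v < bl (sg v) + rd (sg v))%N by rewrite /sg; case: ex_minnP.
have sg_min v s : (v < bl s + rd s)%N -> (sg v <= s)%N.
  by rewrite /sg; case: ex_minnP => m _; apply.
pose nb := fix nb v := if v is u.+1 then (nb u + (nb u < bl (sg u)))%N else 0%N.
pose blue v := (nb v.-1 < bl (sg v.-1))%N.
have nbE v : count blue (iota 1 v) = nb v.
  by elim: v => // v IH; rewrite -[X in iota _ X]addn1 iotaD count_cat IH /= addn0 add1n.
have inv v : (nb v.+1 <= bl (sg v))%N && (v.+1 <= nb v.+1 + rd (sg v))%N.
  elim: v => [|v /andP[IH1 IH2]].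
    by have := sgP 0%N; rewrite /=; case: (bl _) => /=; lia.
  have sv : (sg v <= sg v.+1)%N by apply: sg_min; apply: ltn_trans (sgP v.+1).
  have := mb _ _ sv; have := mr _ _ sv; have := sgP v.+1.
  move: IH1 IH2; rewrite -[nb v.+2]/(nb v.+1 + (nb v.+1 < bl (sg v.+1)))%N.
  by move: (nb v.+1) => m; case: ltnP => /=; lia.
exists blue => s; rewrite nbE.
case E : (bl s + rd s)%N => [|v]; first by have : bl s = 0%N by lia.
have sv : (sg v <= s)%N by apply: sg_min; rewrite E.
have := mb _ _ sv; have := mr _ _ sv; have /andP := inv v; move: E.
by move: (nb v.+1) => m; lia.
Qed.

(** For v in B this is the rank of v among the positive elements of B. *)
Definition index_in (B : pred nat) v := count B (iota 1 v).

Lemma index_in_mono (B : pred nat) u v : (u <= v)%N -> (index_in B u <= index_in B v)%N.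
Proof. by move=> uv; rewrite /index_in -(subnKC uv) iotaD count_cat leq_addr. Qed.

Lemma index_in_lt (B : pred nat) u v : (u < v)%N -> B v -> (index_in B u < index_in B v)%N.
Proof.
move=> uv Bv; case: v uv Bv => // v uv Bv.
apply: (@leq_ltn_trans (index_in B v)); first exact: index_in_mono.
by rewrite /index_in -[v.+1]addn1 iotaD count_cat /= add1n Bv addn1.
Qed.

Lemma index_in_gt0 (B : pred nat) v : (0 < v)%N -> B v -> (0 < index_in B v)%N.
Proof. by move=> v0 Bv; apply: leq_ltn_trans (index_in_lt v0 Bv). Qed.

Lemma index_in_inj (B : pred nat) u v : B u -> B v -> index_in B u = index_in B v -> u = v.
Proof.
move=> Bu Bv E; case: (ltngtP u v) => // h.
  by have := index_in_lt h Bv; rewrite E ltnn.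
by have := index_in_lt h Bu; rewrite E ltnn.
Qed.

(** Distinct vertices have disjoint sets of k children, and the children have
    distinct ranks. *)
Lemma children_bound (k m : nat) (phi : seq 'I_k -> nat) (B : pred nat) (U : seq nat) :
  injective phi -> (forall p, (0 < phi p)%N) -> uniq U ->
  (forall u, u \in U -> exists2 p, phi p = u &
     forall i, B (phi (rcons p i)) && (index_in B (phi (rcons p i)) <= m)%N) ->
  (k * size U <= m)%N.
Proof.
move=> inj pos uU hU.
have /choice[pr hpr] u : exists p, u \in U -> phi p = u /\
     forall i, B (phi (rcons p i)) && (index_in B (phi (rcons p i)) <= m)%N.
  by case: (boolP (u \in U)) => [/hU[p ? ?]|_]; [exists p|exists [::]].
pose w (ui : nat * 'I_k) := index_in B (phi (rcons (pr ui.1) ui.2)).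
pose s := [seq (u, i) | u <- U, i <- enum 'I_k].
have us : uniq s by rewrite allpairs_uniq ?enum_uniq // => -[? ?] [? ?].
have sU ui : ui \in s -> ui.1 \in U by move=> /allpairsP[[u i] [/= ? _ ->]].
have -> : (k * size U = size (map w s))%N.
  by rewrite size_map size_allpairs size_enum_ord mulnC.
rewrite -[leqRHS](size_iota 1); apply: uniq_leq_size.
  rewrite map_inj_in_uniq // => -[u i] [v j] /sU /= uU' /sU /= vU E.
  have [pu hu] := hpr u uU'; have [pv hv] := hpr v vU.
  have /andP[Bu _] := hu i; have /andP[Bv _] := hv j.
  have /inj/eqP := index_in_inj Bu Bv E; rewrite eqseq_rcons => /andP[/eqP E1 /eqP ->].
  by congr (_, _); rewrite -pu -pv E1.
move=> _ /mapP[[u i] /sU /= uU' ->]; have [_ /(_ i)/andP[Bu hm]] := hpr u uU'.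
by rewrite mem_iota add1n ltnS hm andbT index_in_gt0.
Qed.

(** Among the first N numbers, those in B but not in S are missing from S. *)
Lemma count_missing (S : set nat) (B : pred nat) (n N : nat) : (N <= n)%N ->
  (count_upto S n + count B (iota 1 N)
     <= n + size [seq u <- iota 1 N | B u && `[< S u >]])%N.
Proof.
move=> Nn; rewrite /count_upto -(subnKC Nn) iotaD count_cat.
have h1 : (count (fun m => `[< S m >]) (iota 1 N) + count B (iota 1 N)
   <= N + size [seq u <- iota 1 N | B u && `[< S u >]])%N.
  rewrite -count_predUI size_filter; apply: leq_add.
    by rewrite -[leqRHS](size_iota 1); apply: count_size.
  by apply: sub_count => u /=; rewrite andbC.
have h2 := count_size (fun m => `[< S m >]) (iota (1 + N) (n - N)).
by move: h2; rewrite size_iota; lia.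
Qed.

Lemma short_map_le (R : realType) (g : R -> R) x y : short_map g -> 0 <= x -> x <= y ->
  x + g x <= y + g y /\ x - g x <= y - g y.
Proof.
move=> hg x0 xy; have := hg y x (le_trans x0 xy) x0.
rewrite [leRHS]ger0_norm ?subr_ge0 // ler_norml => /andP[h1 h2]; split; lra.
Qed.

Lemma rate_fin (R : realType) (gamma ell t : R) (g : R -> R) :
  short_map g -> g 0 = 0 -> 0 < t -> (rate gamma g t <= ell%:E)%E ->
  exists p m : R, [/\ Gamma_plus gamma g t = p%:E, Gamma_minus gamma g t = m%:E,
    (0 <= p) && (gamma * p + g p == t), (0 <= m) && (gamma * m - g m == t) &
    p + m <= ell * t].
Proof.
move=> hg g0 t0; rewrite /rate Gamma_minusE.
have g0' : - g 0 = 0 by rewrite g0 oppr0.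
have tV : (0 < (t^-1)%:E)%E by rewrite lte_fin invr_gt0.
have [->|[p [-> p0 pE]]] := Gamma_spec gamma hg g0 t0;
  have [->|[m [-> m0 mE]]] := Gamma_spec gamma (short_map_opp hg) g0' t0.
- by rewrite /= gt0_mulye.
- by rewrite /= gt0_mulye.
- by rewrite /= gt0_mulye.
rewrite -EFinD -EFinM lee_fin ler_pdivrMr // => h.
by exists p, m; split=> //; rewrite ?p0 ?m0 ?pE ?mE eqxx.
Qed.

Section Colouring.
Variables (R : realType) (k : nat) (g : R -> R) (blue : pred nat).

Let nb := index_in blue.
Let nr := index_in (predC blue).

(** The j-th red vertex precedes the i-th blue one in the listing: at some
    moment x at least j red vertices have been listed, but not yet i blue ones. *)
Definition red_first (i j : nat) : bool :=
  `[< exists x : R, [/\ 0 <= x, j%:R <= (x + g x) / 2 & (x - g x) / 2 < i%:R] >].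

Definition curve_colouring (u v : nat) : bool :=
  if blue u then (if blue v then false else red_first (nb u) (nr v))
  else (if blue v then red_first (nb v) (nr u) else true).

Lemma curve_colouring_sym : symmetric curve_colouring.
Proof.
by move=> u v; rewrite /curve_colouring; case: (blue u); case: (blue v).
Qed.

Variables (phi : seq 'I_k -> nat) (chi : bool).
Hypothesis phi_inj : injective phi.
Hypothesis phi_pos : forall p, (0 < phi p)%N.
Hypothesis phi_mono : forall p i, curve_colouring (phi p) (phi (rcons p i)) = chi.
Hypothesis g_short : short_map g.
Hypothesis g_0 : g 0 = 0.

Let used (B : pred nat) N := [seq u <- iota 1 N | B u && `[< range phi u >]].

(** A blue vertex of a red copy has red children that precede it. If its rank is
    at most b(x) then theirs are at most r(x). *)
Lemma used_blue_in_red N (x : R) : chi = true -> 0 <= x ->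
  (index_in blue N)%:R <= (x - g x) / 2 ->
  k%:R * (size (used blue N))%:R <= (x + g x) / 2.
Proof.
move=> chiT x0 hN; pose m := Num.truncn ((x + g x) / 2).
have rx0 : 0 <= (x + g x) / 2.
  by have [h _] := short_map_le g_short (lexx 0) x0; rewrite g_0 in h; lra.
suff h : (k * size (used blue N) <= m)%N.
  by rewrite -natrM -truncn_ge_nat.
apply: (children_bound phi_inj phi_pos (B := predC blue)).
  by rewrite filter_uniq ?iota_uniq.
move=> u; rewrite mem_filter mem_iota add1n ltnS => /andP[/andP[bu /asboolP[p _ pu]] uN].
exists p => // i; have := phi_mono p i; rewrite chiT /curve_colouring pu bu.
case bw: (blue _) => // /asboolP[y [y0 hy1 hy2]].
rewrite /= bw /= /m truncn_ge_nat //; apply: (le_trans hy1).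
have yx : y <= x.
  rewrite leNgt; apply/negP => xy.
  have [_ h] := short_map_le g_short x0 (ltW xy).
  have : (nb u)%:R <= (index_in blue N)%:R :> R.
    by rewrite ler_nat index_in_mono //; case/andP: uN.
  lra.
have [h _] := short_map_le g_short y0 yx; lra.
Qed.

Lemma used_red_in_blue N (x : R) : chi = false -> 0 <= x ->
  (index_in (predC blue) N)%:R <= (x + g x) / 2 ->
  k%:R * (size (used (predC blue) N))%:R <= (x - g x) / 2.
Proof.
move=> chiF x0 hN; pose m := Num.truncn ((x - g x) / 2).
have bx0 : 0 <= (x - g x) / 2.
  by have [_ h] := short_map_le g_short (lexx 0) x0; rewrite g_0 in h; lra.
suff h : (k * size (used (predC blue) N) <= m)%N.
  by rewrite -natrM -truncn_ge_nat.
apply: (children_bound phi_inj phi_pos (B := blue)).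
  by rewrite filter_uniq ?iota_uniq.
move=> u; rewrite mem_filter mem_iota add1n ltnS => /andP[/andP[/= bu /asboolP[p _ pu]] uN].
exists p => // i; have := phi_mono p i; rewrite chiF /curve_colouring pu (negbTE bu).
case bw: (blue _) => // /asboolP hE.
rewrite /= /m truncn_ge_nat // leNgt; apply/negP => hlt; apply: hE.
exists x; split=> //; apply: le_trans hN.
by rewrite ler_nat index_in_mono //; case/andP: uN.
Qed.
End Colouring.

(** The stages are the natural numbers s: the first N s vertices are the first
    b(Gamma_minus(s)) blue and the first r(Gamma_plus(s)) red ones, rounded down. *)
Lemma upper_colouring (R : realType) (k : nat) (g : R -> R) (ell theta : R) :
  (0 < k)%N -> short_map g -> g 0 = 0 ->
  (\forall t \near +oo, (rate ((k%:R - 1) / (k%:R + 1)) g t <= ell%:E)%E) ->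
  0 <= theta ->
  theta < 1 / (2 * k%:R / (1 + k%:R) ^+ 2 * ell + 2 * k%:R / (1 + k%:R)) ->
  exists2 c : nat -> nat -> bool, symmetric c &
    forall H' : graph nat, subgraph H' KN -> monochromatic c H' ->
      isomorphic (kary_tree k) H' -> upper_density R (vset H') <= 1 - theta.
Proof.
move=> k0 hg g0 hrate th0 th1.
have k0R : 0 < k%:R :> R by rewrite ltr0n.
have k1 : 0 < k%:R + 1 :> R by lra.
set gamma := (k%:R - 1) / (k%:R + 1) in hrate.
have [T [_ hT]] := hrate.
pose s0 := (Num.truncn `|T|).+1.
have Ts (s : nat) : (s0 <= s)%N -> T < s%:R.
  move=> hs; apply: le_lt_trans (ler_norm T) _; apply: lt_le_trans (truncnS_gt _) _.
  by rewrite ler_nat.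
have s_gt0 (s : nat) : (s0 <= s)%N -> 0 < s%:R :> R.
  by move=> hs; rewrite ltr0n; apply: leq_trans hs.
pose good (s : nat) (pm : R * R) := [/\ Gamma_plus gamma g s%:R = pm.1%:E,
    Gamma_minus gamma g s%:R = pm.2%:E,
    (0 <= pm.1) && (gamma * pm.1 + g pm.1 == s%:R),
    (0 <= pm.2) && (gamma * pm.2 - g pm.2 == s%:R) & pm.1 + pm.2 <= ell * s%:R].
have /choice[pm hpm] : forall s, exists pm, (s0 <= s)%N -> good s pm.
  move=> s; case: (leqP s0 s) => [hs|_]; last by exists (0, 0).
  have [p [m h]] := rate_fin hg g0 (s_gt0 s hs) (hT _ (Ts s hs)).
  by exists (p, m).
pose bv s := ((pm s).2 - g (pm s).2) / 2.
pose rv s := ((pm s).1 + g (pm s).1) / 2.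
have p_ge0 s : (s0 <= s)%N -> 0 <= (pm s).1 by move=> /hpm[_ _ /andP[]].
have m_ge0 s : (s0 <= s)%N -> 0 <= (pm s).2 by move=> /hpm[_ _ _ /andP[]].
have pE s : (s0 <= s)%N -> g (pm s).1 = s%:R - gamma * (pm s).1.
  by move=> /hpm[_ _ /andP[_ /eqP <-] _ _]; ring.
have mE s : (s0 <= s)%N -> g (pm s).2 = gamma * (pm s).2 - s%:R.
  by move=> /hpm[_ _ _ /andP[_ /eqP <-] _]; ring.
have bvE s : (s0 <= s)%N -> bv s = s%:R / 2 + (pm s).2 / (k%:R + 1).
  by move=> hs; rewrite /bv mE // /gamma; field; rewrite gt_eqF.
have rvE s : (s0 <= s)%N -> rv s = s%:R / 2 + (pm s).1 / (k%:R + 1).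
  by move=> hs; rewrite /rv pE // /gamma; field; rewrite gt_eqF.
have bv_ge s : (s0 <= s)%N -> s%:R / 2 <= bv s.
  by move=> hs; rewrite bvE // lerDl divr_ge0 ?m_ge0 // ltW.
have rv_ge s : (s0 <= s)%N -> s%:R / 2 <= rv s.
  by move=> hs; rewrite rvE // lerDl divr_ge0 ?p_ge0 // ltW.
have bv_mono s s' : (s0 <= s)%N -> (s <= s')%N -> bv s <= bv s'.
  move=> hs ss'; have hs' := leq_trans hs ss'.
  have [_ E _ _ _] := hpm s hs; have [_ E' _ _ _] := hpm s' hs'.
  have mm : (pm s).2 <= (pm s').2 by apply: Gamma_plus_mono E E'; rewrite ler_nat.
  by have [_ h] := short_map_le hg (m_ge0 s hs) mm; rewrite /bv; lra.
have rv_mono s s' : (s0 <= s)%N -> (s <= s')%N -> rv s <= rv s'.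
  move=> hs ss'; have hs' := leq_trans hs ss'.
  have [E _ _ _ _] := hpm s hs; have [E' _ _ _ _] := hpm s' hs'.
  have mm : (pm s).1 <= (pm s').1 by apply: Gamma_plus_mono E E'; rewrite ler_nat.
  by have [h _] := short_map_le hg (p_ge0 s hs) mm; rewrite /rv; lra.
pose bl s := if (s0 <= s)%N then Num.truncn (bv s) else 0%N.
pose rd s := if (s0 <= s)%N then Num.truncn (rv s) else 0%N.
have bl_mono : {homo bl : m n / (m <= n)%N}.
  move=> s s' ss'; rewrite /bl; case: (leqP s0 s) => // hs.
  by rewrite (leq_trans hs ss') le_truncn // bv_mono.
have rd_mono : {homo rd : m n / (m <= n)%N}.
  move=> s s' ss'; rewrite /rd; case: (leqP s0 s) => // hs.
  by rewrite (leq_trans hs ss') le_truncn // rv_mono.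
have blP s : (s0 <= s)%N -> (bl s)%:R <= bv s /\ bv s < (bl s)%:R + 1.
  move=> hs; rewrite /bl hs; split; last by rewrite natr1 truncnS_gt.
  by rewrite truncn_le; apply: le_trans (bv_ge s hs).
have rdP s : (s0 <= s)%N -> (rd s)%:R <= rv s /\ rv s < (rd s)%:R + 1.
  move=> hs; rewrite /rd hs; split; last by rewrite natr1 truncnS_gt.
  by rewrite truncn_le; apply: le_trans (rv_ge s hs).
pose N s := (bl s + rd s)%N.
have N_unb v : exists s, (v < bl s + rd s)%N.
  pose s := (s0 + 2 * v + 4)%N; have hs : (s0 <= s)%N by rewrite /s; lia.
  exists s; apply: leq_trans (leq_addr _ _).
  have [_ h] := blP s hs; have h' := bv_ge s hs.
  have : (2 * v + 4)%:R <= s%:R :> R by rewrite ler_nat /s; lia.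
  rewrite natrD natrM => h''; rewrite -(ltr_nat R); lra.
have [blue hblue] := interleaving bl_mono rd_mono N_unb.
have hred s : count (predC blue) (iota 1 (N s)) = rd s.
  have := count_predC blue (iota 1 (N s)); rewrite size_iota hblue /N; lia.
pose cc : R := (k%:R + 1) / (2 * k%:R).
pose Lam : R := 1 + ell / (k%:R + 1).
have ell0 : 0 <= ell.
  have hs := leqnn s0; have [_ _ _ _ h] := hpm s0 hs.
  have : 0 <= ell * s0%:R by apply: le_trans h; rewrite addr_ge0 ?p_ge0 ?m_ge0.
  by rewrite pmulr_lge0 // s_gt0.
have Lam0 : 0 < Lam by rewrite ltr_pwDl // divr_ge0 // ltW.
have thL : theta * Lam < cc.
  have den : 2 * k%:R / (1 + k%:R) ^+ 2 * ell + 2 * k%:R / (1 + k%:R) = Lam / cc.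
    by rewrite /Lam /cc; field; rewrite !gt_eqF // addrC.
  have cc0 : 0 < cc by rewrite divr_gt0 // mulr_gt0.
  by move: th1; rewrite den div1r invf_div ltr_pdivlMr.
have N_le s : (s0 <= s)%N -> (N s)%:R <= s%:R * Lam.
  move=> hs; have [h1 _] := blP s hs; have [h2 _] := rdP s hs.
  have [_ _ _ _ h3] := hpm s hs.
  have : ((pm s).1 + (pm s).2) / (k%:R + 1) <= ell * s%:R / (k%:R + 1).
    by rewrite ler_pM2r ?invr_gt0.
  by rewrite /N natrD; move: h1 h2; rewrite bvE // rvE // /Lam; lra.
exists (curve_colouring g blue); first exact: curve_colouring_sym.
move=> H' [sub _] [chi mono] [phi [phi_im phi_inj0 phi_surj] phi_iso].
have phi_inj : injective phi by move=> p q; apply: phi_inj0; rewrite inE.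
have phi_in p : vset H' (phi p) by apply: phi_im.
have phi_pos p : (0 < phi p)%N by exact: (sub _ (phi_in p)).
have phi_edge p i : curve_colouring g blue (phi p) (phi (rcons p i)) = chi.
  by apply: mono; apply/phi_iso => //; left; exists i.
have imE : vset H' = range phi.
  by apply/seteqP; split=> [v /phi_surj //|_ [p _ <-]].
(* A copy of either colour misses cc s of the first N s vertices, up to
   rounding. *)
have missing s n : (s0 <= s)%N -> (N s <= n)%N ->
    (count_upto (vset H') n)%:R + (cc * s%:R - 1) <= n%:R.
  move=> hs Nn.
  have kdiv (x y z : R) : k%:R * x <= y -> z = cc * s%:R + y / k%:R -> x + cc * s%:R <= z.
    move=> h ->; rewrite addrC lerD2l ler_pdivlMr //; lra.
  case: chi mono phi_edge => _ phi_edge.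
    have h := used_blue_in_red phi_inj phi_pos phi_edge hg g0 (N := N s) erefl (m_ge0 s hs).
    rewrite /index_in hblue in h; have [h1 h2] := blP s hs.
    have := count_missing (vset H') blue Nn; rewrite hblue imE -(ler_nat R) !natrD.
    have := kdiv _ _ (bv s) (h h1); set U := size _ => hU hc.
    suff E : bv s = cc * s%:R + ((pm s).2 + g (pm s).2) / 2 / k%:R by have := hU E; lra.
    by rewrite /bv mE // /cc /gamma; field; rewrite !gt_eqF.
  have h := used_red_in_blue phi_inj phi_pos phi_edge hg g0 (N := N s) erefl (p_ge0 s hs).
  rewrite /index_in hred in h; have [h1 h2] := rdP s hs.
  have := count_missing (vset H') (predC blue) Nn; rewrite hred imE -(ler_nat R) !natrD.
  have := kdiv _ _ (rv s) (h h1); set U := size _ => hU hc.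
  suff E : rv s = cc * s%:R + ((pm s).1 - g (pm s).1) / 2 / k%:R by have := hU E; lra.
  by rewrite /rv pE // /cc /gamma; field; rewrite !gt_eqF.
have gap0 : 0 < cc - theta * Lam by rewrite subr_gt0.
pose s1 := maxn s0 (Num.truncn ((1 + theta * Lam) / (cc - theta * Lam))).+1.
have s1P (s : nat) : (s1 <= s)%N -> theta * (s.+1%:R * Lam) <= cc * s%:R - 1.
  move=> hs; have : (1 + theta * Lam) / (cc - theta * Lam) < s%:R.
    by apply: lt_le_trans (truncnS_gt _) _; rewrite ler_nat (leq_trans _ hs) // leq_maxr.
  by rewrite ltr_pdivrMr // -natr1; lra.
apply: (@upper_density_le R _ _ (N s1)) => n n1.
(* n lies between the consecutive stages s and s.+1. *)
have [s' hs' s'min] := ex_minnP (N_unb n).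
have ss' : (s1 < s')%N.
  rewrite ltnNge; apply/negP => h.
  have : (N s' <= N s1)%N by rewrite leq_add ?bl_mono ?rd_mono.
  by move: hs'; rewrite /N in n1 *; lia.
case: s' hs' s'min ss' => // s hs' s'min; rewrite ltnS => s1s.
have s0s : (s0 <= s)%N by apply: leq_trans s1s; rewrite leq_maxl.
have Nn : (N s <= n)%N by rewrite leqNgt; apply/negP => /s'min; rewrite ltnn.
have h1 := missing s n s0s Nn; have h2 := s1P s s1s.
have h3 := N_le s.+1 (leq_trans s0s (leqnSn s)).
have h4 : n%:R < (N s.+1)%:R :> R by rewrite ltr_nat.
have h5 : theta * n%:R <= theta * (s.+1%:R * Lam) by rewrite ler_wpM2l //; lra.
by rewrite mulrBl mul1r; lra.
Qed.

(** * The Ramsey upper density of the tree *)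

Theorem corollary5 (R : realType) (k : nat) (k_gt0 : (0 < k)%N) :
  ramsey_upper_density R (kary_tree k) = tree_density (k%:R : R)%:E.
Proof.
have k1 : 1 <= k%:R :> R by rewrite ler1n.
have k0R : 0 < k%:R :> R by lra.
have [|h hE h0] := @hfun_fin R ((k%:R - 1) / (k%:R + 1)).
  by rewrite divr_ge0 //; lra.
rewrite /tree_density gt_eqF // hE /=.
pose al : R := 2 * k%:R / (1 + k%:R) ^+ 2.
pose be : R := 2 * k%:R / (1 + k%:R).
have al0 : 0 < al by rewrite divr_gt0 ?mulr_gt0 ?exprn_gt0 //; lra.
have be0 : 0 < be by rewrite divr_gt0 ?mulr_gt0 //; lra.
rewrite -/al -/be; set F := 1 - _.
have den0 : 0 < al * h + be by rewrite ltr_wpDl // mulr_ge0 // ltW.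
rewrite /ramsey_upper_density; set S := [set l | _].
have lower mu : mu < F -> S mu.
  by move=> muF c c_sym; exact: (tree_density_lower k_gt0 hE c_sym muF).
have upper l : S l -> l <= F.
  move=> Sl; rewrite leNgt; apply/negP => Fl.
  pose theta := Num.max 0 ((1 - l + 1 / (al * h + be)) / 2).
  have th0 : 0 <= theta by rewrite le_max lexx.
  have th1 : theta < 1 / (al * h + be).
    by rewrite gt_max divr_gt0 //=; move: Fl; rewrite /F; lra.
  have thl : 1 - theta < l.
    have : (1 - l + 1 / (al * h + be)) / 2 <= theta by rewrite le_max lexx orbT.
    by move: Fl; rewrite /F; lra.
  have thden : theta * (al * h + be) < 1 by rewrite -ltr_pdivlMr.
  pose d := (1 - theta * (al * h + be)) / (2 * (theta * al + 1)).
  have ta0 : 0 <= theta * al by rewrite mulr_ge0 // ltW.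
  have d0 : 0 < d by rewrite divr_gt0 ?subr_gt0 // mulr_gt0 //; lra.
  have hd : h < h + d by rewrite ltrDl.
  have dE : d * (theta * al + 1) = (1 - theta * (al * h + be)) / 2.
    by rewrite /d; field; rewrite gt_eqF //; lra.
  have [g [hg g0 hrate]] := hfun_approx hE hd.
  have [|c c_sym hc] := upper_colouring k_gt0 hg g0 hrate th0.
    rewrite -/al -/be ltr_pdivlMr; last by rewrite ltr_wpDl // mulr_ge0 ?ltW //; lra.
    lra.
  have [H' [h1 h2 h3 h4]] := Sl c c_sym.
  have := hc H' h1 h2 h3; lra.
have S0 : S !=set0 by exists (F - 1); apply: lower; lra.
apply/le_anti/andP; split; first by apply: ge_sup => // l /upper.
rewrite leNgt; apply/negP => ltF.
have /lower Smu : (sup S + F) / 2 < F by lra.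
have : (sup S + F) / 2 <= sup S by apply: ub_le_sup => //; exists F => l /upper.
lra.
Qed.
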